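(* Consider the controlled Markov chain with vector rewards in which the player follows the strategy-switching scheme described in the context, the adversary acting arbitrarily. Let $(x_n)$ be a realization of the sequence of average rewards which lies outside the exceptional null set $N$. If $x$ is a limit point of the sequence $(x_n)$, then $x\in\bar D$.
   Context: **Model.** $S$ is a finite state space, $U^p,U^a$ are finite action sets (of the player and the adversary), $p(\theta'\mid\theta,u^p,u^a)$ is a transition kernel on $S$, $K\subset\mathbb R^d$ is compact, and $\kappa:S\times U^p\times U^a\to K$ is the one-step reward. $\Pi^p$ (resp. $\Pi^a$) is the set of all maps (strategies) $S\to\mathcal P(U^p)$ (resp. $S\to\mathcal P(U^a)$), where $\mathcal P$ denotes probability distributions; write $\pi(u\mid\theta)$. Standing assumption: for every fixed $(\pi^p,\pi^a)\in\Pi^p\times\Pi^a$ the resulting Markov chain on $S$ is ergodic; $\eta^{(\pi^p,\pi^a)}$ is its stationary distribution. Put $\bar\kappa(\pi^p,\pi^a)=\sum_{\theta,u^p,u^a}\kappa(\theta,u^p,u^a)\,\eta^{(\pi^p,\pi^a)}(\theta)\,\pi^p(u^p\mid\theta)\,\pi^a(u^a\mid\theta)$ and $R(\pi^p)=\{\bar\kappa(\pi^p,\pi^a):\pi^a\in\Pi^a\}$, with closure $\overline{R(\pi^p)}$. **Target set.** $D\subset K$ is nonempty, with convex closure $\bar D$. For $x\in\mathbb R^d$, $x_{\bar D}$ is the unique point of $\bar D$ closest to $x$. Standing assumption: for every $x\in K\setminus\bar D$ there is $\pi^p_x\in\Pi^p$ with $\inf_{\pi^a\in\Pi^a}\langle\bar\kappa(\pi^p_x,\pi^a)-x_{\bar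 D},\,x_{\bar D}-x\rangle>0$; one such $\pi_x^p$ is fixed for each $x$. $B(x,r)$ is the open ball in $\mathbb R^d$. Fix $\rho:K\setminus\bar D\to(0,\infty)$ such that for all $x\in K\setminus\bar D$: $\inf_{y\in B(x,\rho(x))}\inf_{\pi^a\in\Pi^a}\langle\bar\kappa(\pi^p_x,\pi^a)-y_{\bar D},\,y_{\bar D}-y\rangle>0$. **Discretization.** For integers $n\ge1$, $K_n=\{y\in K:\inf_{x\in D}\|y-x\|\in[1/(n+1),1/n]\}$, and $K_0=\{y\in K:\inf_{x\in D}\|y-x\|\ge1\}$. For each $n\ge 0$, $\mathcal Q_n\subset K_n$ is a fixed finite set with $\bigcup_{q\in\mathcal Q_n}B(q,\rho(q)/2)\supset K_n$; $\mathcal Q=\bigcup_n\mathcal Q_n$. $I:\mathcal Q\to\mathbb N$ is a fixed injection, and for $x\in K\setminus\bar D$, $Q(x)$ is the $q\in\mathcal Q$ with $x\in B(q,\rho(q)/2)$ minimizing $I(q)$. Let $v_{\max}=\sup_{x\in K}\sup_{(\theta,u^p,u^a)}\|\kappa(\theta,u^p,u^a)-x\|$, and fix $T:\mathcal Q\to(0,\infty)$ with $\rho(q)/(4v_{\max})<T(q)<\rho(q)/(3v_{\max})$ for all $q\in\mathcal Q$. **Process and scheme.** At each time $n\ge0$, depending on the past, the player and adversary choose strategies $\pi^p_{(n)}\in\Pi^p$, $\pi^a_{(n)}\in\Pi^a$; given the past (including $\theta_n$), the actions $u^p_n\sim\pi^p_{(n)}(\cdot\mid\theta_n)$ and $u^a_n\sim\pi^a_{(n)}(\cdot\mid\theta_n)$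 are drawn independently, and $\theta_{n+1}\sim p(\cdot\mid\theta_n,u^p_n,u^a_n)$. The adversary's choices are otherwise arbitrary. The average reward satisfies $x_{n+1}=x_n+\frac1{n+1}[\kappa(\theta_n,u^p_n,u^a_n)-x_n]$, $x_0\in K$, and it is assumed that $x_n\in K$ for all $n$ (automatic if $K$ is convex). The player changes strategy at times $\mathcal S=(s_n)$, $s_0=0$, defined recursively: if $x_{s_n}\in K\setminus\bar D$, put $q=Q(x_{s_n})$, use $\pi^p_q$ at all times $s_n\le i<s_{n+1}$, where $s_{n+1}=\min\{m:\sum_{i=s_n}^{m-1}1/i>T(q)\}$ (convention $1/0=+\infty$, relevant only for $s_0=0$); if $x_{s_n}\in\bar D$, use a fixed arbitrary strategy $\pi^p_0$ at time $s_n$ and put $s_{n+1}=s_n+1$. **Trajectories.** $t(0)=0$, $t(n)=\sum_{i=1}^n1/i$; $\bar x(\cdot)$ on $[0,\infty)$ is the piecewise linear interpolation with $\bar x(t(n))=x_n$. For an increasing subsequence $(s_{m(n)})$ of $\mathcal S$ let $\bar y_{m(n)}(t)=\bar x(t(s_{m(n)})+t)$ if $0\le t\le t(s_{m(n)+1})-t(s_{m(n)})$, and $\bar y_{m(n)}(t)=\bar x(t(s_{m(n)+1}))$ for larger $t$. **Exceptional set.** For $q\in\mathcal Q$, $T=T(q)$, $k\in\mathbb N$, $j\in J_k=\{0,\dots,2^k-1\}$ and a continuous $\bar y:[0,\infty)\to\mathbb R^d$ put $\kappa_{j,k}=\dfrac{\bar y(2^{-k}(j+1)T)-e^{-2^{-k}T}\bar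 y(2^{-k}jT)}{1-e^{-2^{-k}T}}$. $N(q,j,k)$ is the set of realizations $(x_n)$ for which there exist an increasing subsequence $(s_{m(n)})$ of $\mathcal S$ with $x_{s_{m(n)}}$ converging to a point of $K\setminus\bar D$ and $Q(x_{s_{m(n)}})=q$ for all $n$, and a continuous $\bar y$ with $\bar y_{m(n)}\to\bar y$ uniformly on compacts, such that $\kappa_{j,k}\notin\overline{R(\pi^p_q)}$. Finally $N=\bigcup_{q\in\mathcal Q}\bigcup_{k\in\mathbb N}\bigcup_{j\in J_k}N(q,j,k)$. *)

(* Defs.v *)
From HB Require Import structures.
From mathcomp Require Import all_boot all_order all_algebra.
From mathcomp Require Import all_classical all_reals all_analysis.

Set Implicit Arguments.
Unset Strict Implicit.
Unset Printing Implicit Defensive.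

Import Order.TTheory GRing.Theory Num.Theory.
Import numFieldNormedType.Exports.
Local Open Scope classical_set_scope.
Local Open Scope ring_scope.

(** ** Euclidean structure of R^d *)

(* The norm [`|x|] that MathComp-Analysis puts on ['rV[R]_d] is the sup norm;
   everything metric below uses the Euclidean norm [enorm].  The topology
   ([closure], [compact], convergence) is the same for both norms. *)
Definition dotp (R : realType) (d : nat) (x y : 'rV[R]_d) : R :=
  \sum_i x 0 i * y 0 i.

Definition enorm (R : realType) (d : nat) (x : 'rV[R]_d) : R :=
  Num.sqrt (dotp x x).

Definition eball (R : realType) (d : nat) (x : 'rV[R]_d) (r : R) :
  set 'rV[R]_d := [set y | enorm (y - x) < r].

Definition edist (R : realType) (d : nat) (D : set 'rV[R]_d) (y : 'rV[R]_d) :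
  R := inf [set enorm (y - x) | x in D].

(* [proj D x] is the point of the closure of [D] closest to [x]; it is unique
   when that closure is convex and nonempty. *)
Definition proj (R : realType) (d : nat) (D : set 'rV[R]_d) (x : 'rV[R]_d) :
  'rV[R]_d :=
  xget x [set z | closure D z /\
                  forall w, closure D w -> enorm (x - z) <= enorm (x - w)].

(** ** Strategies and Markov chains on a finite state space *)

Definition is_distr (R : realType) (U : finType) (f : U -> R) : Prop :=
  (forall u, 0 <= f u) /\ \sum_u f u = 1.

Definition strategies (R : realType) (S U : finType) : set (S -> U -> R) :=
  [set sigma | forall th, is_distr (sigma th)].
Arguments strategies : clear implicits.

Fixpoint nsteps (R : realType) (S : finType) (A : S -> S -> R) (n : nat)
    (i j : S) : R :=
  if n is n'.+1 then \sum_k A i k * nsteps A n' k j else (i == j)%:R.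

Definition irreducible_chain (R : realType) (S : finType) (A : S -> S -> R) :=
  forall i j, exists n, 0 < nsteps A n i j.

Definition aperiodic_chain (R : realType) (S : finType) (A : S -> S -> R) :=
  forall (i : S) (g : nat),
    (forall n, (0 < n)%N -> 0 < nsteps A n i i -> (g %| n)%N) -> g = 1%N.

Definition ergodic_chain (R : realType) (S : finType) (A : S -> S -> R) :=
  irreducible_chain A /\ aperiodic_chain A.

(* Unique when the chain is ergodic. *)
Definition stationary_distr (R : realType) (S : finType) (A : S -> S -> R) :
  {ffun S -> R} :=
  xget [ffun=> 0] [set eta : {ffun S -> R} | is_distr eta /\
                     forall j, \sum_i eta i * A i j = eta j].

(** ** Data of the model and of the switching scheme *)

(* [strat x] and [rho x] are only meaningful for [x] in [Kset] outside the
   closure of [target], [idx q] and [dur q] only for [q] in the union of the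
   [Qn n]. *)
Record setting (R : realType) (d : nat) (St Up Ua : finType) := Setting {
  (* [trans th up ua th'] is p(th' | th, up, ua). *)
  trans : St -> Up -> Ua -> St -> R;
  Kset : set 'rV[R]_d;
  kappa : St -> Up -> Ua -> 'rV[R]_d;
  target : set 'rV[R]_d;
  strat : 'rV[R]_d -> St -> Up -> R;
  strat0 : St -> Up -> R;
  rho : 'rV[R]_d -> R;
  Qn : nat -> set 'rV[R]_d;
  idx : 'rV[R]_d -> nat;
  dur : 'rV[R]_d -> R
}.

Definition chain (R : realType) (d : nat) (St Up Ua : finType)
    (M : setting R d St Up Ua) (pip : St -> Up -> R) (pia : St -> Ua -> R)
    (th th' : St) : R :=
  \sum_up \sum_ua pip th up * pia th ua * trans M th up ua th'.

Definition kbar (R : realType) (d : nat) (St Up Ua : finType)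
    (M : setting R d St Up Ua) (pip : St -> Up -> R) (pia : St -> Ua -> R) :
    'rV[R]_d :=
  \sum_th \sum_up \sum_ua
    (stationary_distr (chain M pip pia) th * pip th up * pia th ua)
      *: kappa M th up ua.

Definition rewards (R : realType) (d : nat) (St Up Ua : finType)
    (M : setting R d St Up Ua) (pip : St -> Up -> R) : set 'rV[R]_d :=
  [set kbar M pip pia | pia in strategies R St Ua].

(* The infimum over the adversary's strategies of
   <kbar(pip, pia) - y_D, y_D - y>, as an extended real. *)
Definition drift (R : realType) (d : nat) (St Up Ua : finType)
    (M : setting R d St Up Ua) (pip : St -> Up -> R) (y : 'rV[R]_d) : \bar R :=
  let yD := proj (target M) y in
  ereal_inf [set (dotp (kbar M pip pia - yD) (yD - y))%:E
            | pia in strategies R St Ua].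

Definition off_target (R : realType) (d : nat) (St Up Ua : finType)
    (M : setting R d St Up Ua) : set 'rV[R]_d := Kset M `\` closure (target M).

Definition shell (R : realType) (d : nat) (St Up Ua : finType)
    (M : setting R d St Up Ua) (n : nat) : set 'rV[R]_d :=
  if n is 0%N then [set y | Kset M y /\ 1 <= edist (target M) y]
  else [set y | Kset M y /\ n.+1%:R^-1 <= edist (target M) y <= n%:R^-1].

Definition Qset (R : realType) (d : nat) (St Up Ua : finType)
    (M : setting R d St Up Ua) : set 'rV[R]_d := \bigcup_n Qn M n.

(* The point Q(x): the [q] of least index with [x] in B(q, rho(q)/2). *)
Definition Qpt (R : realType) (d : nat) (St Up Ua : finType)
    (M : setting R d St Up Ua) (x : 'rV[R]_d) : 'rV[R]_d :=
  xget x [set q | [/\ Qset M q, eball q (rho M q / 2) x &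
                      forall q', Qset M q' -> eball q' (rho M q' / 2) x ->
                        (idx M q <= idx M q')%N]].

Definition vmax (R : realType) (d : nat) (St Up Ua : finType)
    (M : setting R d St Up Ua) : R :=
  sup [set enorm (kappa M z.1.1 z.1.2 z.2 - x)
      | x in Kset M & z in [set: St * Up * Ua]].

Record standing_assumptions (R : realType) (d : nat) (St Up Ua : finType)
    (M : setting R d St Up Ua) : Prop := StandingAssumptions {
  trans_distr : forall th up ua, is_distr (trans M th up ua);
  Kset_compact : compact (Kset M);
  kappa_Kset : forall th up ua, Kset M (kappa M th up ua);
  ergodicity : forall pip pia,
    strategies R St Up pip -> strategies R St Ua pia ->
    ergodic_chain (chain M pip pia);
  target_sub : target M `<=` Kset M;
  target_nonempty : target M !=set0;
  target_convex :
    convex_set (closure (target M) : set (convex_lmodType 'rV[R]_d));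
  strat_strategy : forall x, off_target M x -> strategies R St Up (strat M x);
  strat_drift : forall x, off_target M x -> (0 < drift M (strat M x) x)%E;
  strat0_strategy : strategies R St Up (strat0 M);
  rho_gt0 : forall x, off_target M x -> 0 < rho M x;
  rho_drift : forall x, off_target M x ->
    (0 < ereal_inf [set drift M (strat M x) y | y in eball x (rho M x)])%E;
  Qn_finite : forall n, finite_set (Qn M n);
  Qn_sub : forall n, Qn M n `<=` shell M n;
  Qn_cover : forall n,
    shell M n `<=` \bigcup_(q in Qn M n) eball q (rho M q / 2);
  idx_inj : set_inj (Qset M) (idx M);
  dur_gt0 : forall q, Qset M q -> 0 < dur M q;
  dur_bounds : forall q, Qset M q ->
    rho M q / (4 * vmax M) < dur M q < rho M q / (3 * vmax M)
}.

(** ** Switching times and interpolated trajectories of a sequence *)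

(* In [\bar R] the inverse of 0 is [+oo], which is the convention 1/0 = +oo. *)
Definition next_switch (R : realType) (d : nat) (St Up Ua : finType)
    (M : setting R d St Up Ua) (x : nat -> 'rV[R]_d) (s : nat) : nat :=
  if `[< off_target M (x s) >] then
    let elapsed m := (\sum_(s <= i < m) ((i%:R)%:E)^-1)%E in
    let Tq := (dur M (Qpt M (x s)))%:E in
    xget s.+1 [set m | (Tq < elapsed m)%E /\
                       forall m', (Tq < elapsed m')%E -> (m <= m')%N]
  else s.+1.

Definition switch (R : realType) (d : nat) (St Up Ua : finType)
    (M : setting R d St Up Ua) (x : nat -> 'rV[R]_d) (n : nat) : nat :=
  iter n (next_switch M x) 0%N.

Definition clock (R : realType) (n : nat) : R :=
  \sum_(1 <= i < n.+1) (i%:R)^-1.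

Definition xbar (R : realType) (d : nat) (x : nat -> 'rV[R]_d) (t : R) :
    'rV[R]_d :=
  let n := xget 0%N [set n | clock R n <= t < clock R n.+1] in
  x n + ((t - clock R n) / (clock R n.+1 - clock R n)) *: (x n.+1 - x n).

(* The trajectory started at the [l]-th switching time. *)
Definition ybar (R : realType) (d : nat) (St Up Ua : finType)
    (M : setting R d St Up Ua) (x : nat -> 'rV[R]_d) (l : nat) (t : R) :
    'rV[R]_d :=
  let t0 := clock R (switch M x l) in
  let t1 := clock R (switch M x l.+1) in
  if t <= t1 - t0 then xbar x (t0 + t) else xbar x t1.

(** ** Exceptional set *)

Definition kappa_jk (R : realType) (d : nat) (Tq : R) (j k : nat)
    (y : R -> 'rV[R]_d) : 'rV[R]_d :=
  let h := 2 ^- k * Tq in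
  (1 - expR (- h))^-1 *: (y (h * j.+1%:R) - expR (- h) *: y (h * j%:R)).

Definition exceptional_at (R : realType) (d : nat) (St Up Ua : finType)
    (M : setting R d St Up Ua) (q : 'rV[R]_d) (j k : nat) :
    set (nat -> 'rV[R]_d) :=
  [set x | exists (m : nat -> nat) (y : R -> 'rV[R]_d),
    [/\ {homo m : a b / (a < b)%N},
        exists2 z, off_target M z & x (switch M x (m n)) @[n --> \oo] --> z,
        forall n, off_target M (x (switch M x (m n))) /\
                  Qpt M (x (switch M x (m n))) = q,
        {within `[0, +oo[, continuous y} /\
        (forall C : set R, compact C -> C `<=` `[0, +oo[ ->
          {uniform C, (fun n => ybar M x (m n)) @ \oo --> y}) &
        ~ closure (rewards M (strat M q)) (kappa_jk (dur M q) j k y)]].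

Definition exceptional (R : realType) (d : nat) (St Up Ua : finType)
    (M : setting R d St Up Ua) : set (nat -> 'rV[R]_d) :=
  \bigcup_(q in Qset M) \bigcup_k \bigcup_(j in `I_(2 ^ k))
    exceptional_at M q j k.

(** ** The controlled process *)

(* [F n] is the past at time [n], including the state [th n] but not the
   actions [up n] and [ua n]; it may be larger than the history of the game, so
   that the adversary is free to randomize. *)
Record controlled_process (R : realType) (d : nat) (St Up Ua : finType)
    (M : setting R d St Up Ua) (disp : measure_display)
    (Omega : measurableType disp) (P : probability Omega R)
    (F : nat -> set (set Omega))
    (th : nat -> Omega -> St) (up : nat -> Omega -> Up) (ua : nat -> Omega -> Ua)
    (pip : nat -> Omega -> St -> Up -> R) (pia : nat -> Omega -> St -> Ua -> R)
    (x : nat -> Omega -> 'rV[R]_d) : Prop := ControlledProcess {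
  F_sigma : forall n, sigma_algebra [set: Omega] (F n);
  F_measurable : forall n, F n `<=` measurable;
  F_mono : forall n, F n `<=` F n.+1;
  th_adapted : forall n s, F n [set w | th n w = s];
  up_adapted : forall n a, F n.+1 [set w | up n w = a];
  ua_adapted : forall n b, F n.+1 [set w | ua n w = b];
  x0_adapted : forall i,
    measurable_fun [set: g_sigma_algebraType (F 0%N)]
      (fun w : Omega => x 0%N w 0 i);
  pip_strategy : forall n w, strategies R St Up (pip n w);
  pia_strategy : forall n w, strategies R St Ua (pia n w);
  pip_adapted : forall n s a,
    measurable_fun [set: g_sigma_algebraType (F n)]
      (fun w : Omega => pip n w s a);
  pia_adapted : forall n s b,
    measurable_fun [set: g_sigma_algebraType (F n)]
      (fun w : Omega => pia n w s b);
  (* The next two fields give, in integrated form, the law of the actions given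
     [F n], then that of the next state given [F n] and the actions. *)
  action_law : forall n A a b, F n A ->
    P (A `&` [set w | up n w = a /\ ua n w = b]) =
    (\int[P]_(w in A) (pip n w (th n w) a * pia n w (th n w) b)%:E)%E;
  state_law : forall n A a b s, F n A ->
    P (A `&` [set w | up n w = a /\ ua n w = b] `&` [set w | th n.+1 w = s]) =
    (\int[P]_(w in A `&` [set w | up n w = a /\ ua n w = b])
       (trans M (th n w) a b s)%:E)%E;
  x_rec : forall n w,
    x n.+1 w =
    x n w + n.+1%:R^-1 *: (kappa M (th n w) (up n w) (ua n w) - x n w);
  x_Kset : forall n w, Kset M (x n w);
  player_scheme : forall w n i,
    (switch M (x ^~ w) n <= i < switch M (x ^~ w) n.+1)%N ->
    (off_target M (x (switch M (x ^~ w) n) w) ->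
       pip i w = strat M (Qpt M (x (switch M (x ^~ w) n) w))) /\
    (closure (target M) (x (switch M (x ^~ w) n) w) -> pip i w = strat0 M)
}.

(* Main.v *)
Require Import Defs.
From mathcomp Require Import all_boot all_order all_algebra.
From mathcomp Require Import all_classical all_reals all_analysis.
From mathcomp Require Import ring lra.
Import Order.TTheory GRing.Theory Num.Theory.
Import numFieldNormedType.Exports.
Import Defs.
Set Implicit Arguments.
Unset Strict Implicit.
Local Open Scope classical_set_scope.
Local Open Scope ring_scope.

(* Let f be the distance to the closure of D.  Along a limit of the trajectories
   started at switching times with a given Q(x) = q, consecutive values at the
   times jh, h = 2^-k T(q), are joined by a convex combination with kappa_{j,k},
   which lies in the closure of R(pi_q) outside N; the drift condition makes f^2
   decrease by a multiple of h at each step, up to an error O(h^2), so one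
   sufficiently large k yields a definite decrease of f^2 over [0, T(q)].  By
   Arzela-Ascoli this passes to the actual sequence: f(x_{s_l})^2 drops by at
   least c_q when Q(x_{s_l}) = q and l is large.  Only finitely many q occur while
   f >= e, so f(x_{s_l}) is below e infinitely often; and since
   rho(q) <= 2 f(x_{s_l}), f grows at most by a factor 5/3, up to o(1), between two
   switches, so f(x_n) <= 4e eventually. *)

(** * Euclidean norm and closest points *)

Section Euclidean.
Variables (R : realType) (d : nat).
Implicit Types (x y z : 'rV[R]_d) (a : R).

Lemma dotpC x y : dotp x y = dotp y x.
Proof. by apply: eq_bigr => i _; rewrite mulrC. Qed.

Lemma dotpDl x y z : dotp (x + y) z = dotp x z + dotp y z.
Proof. by rewrite -big_split; apply: eq_bigr => i _; rewrite mxE mulrDl. Qed.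

Lemma dotpZl a x y : dotp (a *: x) y = a * dotp x y.
Proof. by rewrite mulr_sumr; apply: eq_bigr => i _; rewrite mxE mulrA. Qed.

Lemma dotpNl x y : dotp (- x) y = - dotp x y.
Proof. by rewrite -scaleN1r dotpZl mulN1r. Qed.

Lemma dotpBl x y z : dotp (x - y) z = dotp x z - dotp y z.
Proof. by rewrite dotpDl dotpNl. Qed.

Lemma dotpDr x y z : dotp z (x + y) = dotp z x + dotp z y.
Proof. by rewrite ![dotp z _]dotpC dotpDl. Qed.

Lemma dotpZr a x y : dotp y (a *: x) = a * dotp y x.
Proof. by rewrite ![dotp y _]dotpC dotpZl. Qed.

Lemma dotpNr x y : dotp y (- x) = - dotp y x.
Proof. by rewrite ![dotp y _]dotpC dotpNl. Qed.

Lemma dotpBr x y z : dotp z (x - y) = dotp z x - dotp z y.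
Proof. by rewrite dotpDr dotpNr. Qed.

Lemma dotp_ge0 x : 0 <= dotp x x.
Proof. by apply: sumr_ge0 => i _; rewrite -expr2 sqr_ge0. Qed.

Lemma enorm_ge0 x : 0 <= enorm x.
Proof. exact: sqrtr_ge0. Qed.

Lemma enorm_sqr x : enorm x ^+ 2 = dotp x x.
Proof. by rewrite sqr_sqrtr ?dotp_ge0. Qed.

Lemma enormZ a x : enorm (a *: x) = `|a| * enorm x.
Proof.
by rewrite /enorm dotpZl dotpZr mulrA -expr2 sqrtrM ?sqr_ge0// sqrtr_sqr.
Qed.

Lemma enormN x : enorm (- x) = enorm x.
Proof. by rewrite -scaleN1r enormZ normrN1 mul1r. Qed.

Lemma enormC x y : enorm (x - y) = enorm (y - x).
Proof. by rewrite -enormN opprB. Qed.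

Lemma ler_norm_enorm x : `|x| <= enorm x.
Proof.
rewrite [leLHS]mx_normrE; apply: bigmax_le => [|[i j] _ /=].
  exact: enorm_ge0.
rewrite ord1 -(ler_pXn2r (n := 2)) ?nnegrE ?enorm_ge0//.
rewrite enorm_sqr /dotp (bigD1 j)//= real_normK ?num_real// expr2 lerDl.
by apply: sumr_ge0 => k _; rewrite -expr2 sqr_ge0.
Qed.

Lemma enorm_eq0 x : (enorm x == 0) = (x == 0).
Proof.
apply/eqP/eqP => [x0|->]; last by rewrite -(scale0r 0) enormZ normr0 mul0r.
by apply/normr0_eq0/le_anti; rewrite normr_ge0 -x0 ler_norm_enorm.
Qed.

Lemma enorm0 : enorm (0 : 'rV[R]_d) = 0.
Proof. by apply/eqP; rewrite enorm_eq0. Qed.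

(** Cauchy-Schwarz: with the zero cases split off, expand the nonnegative square norm of |y| x - |x|
    y and cancel 2 |x| |y|. *)
Lemma dotp_le_enorm x y : dotp x y <= enorm x * enorm y.
Proof.
have [->|x0] := eqVneq x 0.
  by rewrite -{1}(scale0r 0) dotpZl mul0r enorm0 mul0r.
have [->|y0] := eqVneq y 0.
  by rewrite -{1}(scale0r 0) dotpZr mul0r enorm0 mulr0.
have xp : 0 < enorm x by rewrite lt_def enorm_eq0 x0 enorm_ge0.
have yp : 0 < enorm y by rewrite lt_def enorm_eq0 y0 enorm_ge0.
have := dotp_ge0 (enorm y *: x - enorm x *: y).
rewrite !(dotpBl, dotpBr, dotpZl, dotpZr) -!enorm_sqr (dotpC y x) => h.
rewrite -(ler_pM2l (mulr_gt0 xp yp)).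
rewrite -(ler_pM2l (ltr0n R 2)) -subr_ge0; apply: le_trans h _.
by rewrite le_eqVlt; apply/orP; left; apply/eqP; ring.
Qed.

Lemma enormD_sqr x y :
  enorm (x + y) ^+ 2 = enorm x ^+ 2 + 2 * dotp x y + enorm y ^+ 2.
Proof. by rewrite !enorm_sqr dotpDl !dotpDr (dotpC y x); ring. Qed.

Lemma ler_enormD x y : enorm (x + y) <= enorm x + enorm y.
Proof.
rewrite -(ler_pXn2r (n := 2)) ?nnegrE ?addr_ge0 ?enorm_ge0//.
by rewrite sqrrD enormD_sqr; have := dotp_le_enorm x y; lra.
Qed.

Lemma ler_enorm_dist x y z : enorm (x - z) <= enorm (x - y) + enorm (y - z).
Proof. by apply: le_trans (ler_enormD _ _); rewrite addrA subrK. Qed.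

Lemma ler_enorm_norm x : enorm x <= d%:R * `|x|.
Proof.
rewrite -(ler_pXn2r (n := 2)) ?nnegrE ?mulr_ge0 ?enorm_ge0//.
rewrite enorm_sqr; apply: (@le_trans _ _ (\sum_(i < d) `|x| ^+ 2)).
  apply: ler_sum => i _; rewrite -expr2 -real_normK ?num_real//.
  rewrite lerXn2r ?nnegrE// [leRHS]mx_normrE.
  by apply: (le_bigmax _ (fun ij => `|x ij.1 ij.2|) (ord0, i)).
rewrite sumr_const card_ord -[leLHS]mulr_natl exprMn ler_wpM2r ?sqr_ge0//.
by rewrite -natrX ler_nat; case: (d) => // n; rewrite expnS expn1 leq_pmulr.
Qed.

(** Bridge from the sup-norm topology to Euclidean balls, by |x|_sup <= |x| <= d |x|_sup. *)
Lemma nbhs_enormP x (A : set 'rV[R]_d) :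
  nbhs x A <-> exists2 e, 0 < e & eball x e `<=` A.
Proof.
have d1 : 0 < d%:R + 1 :> R by rewrite ltr_wpDl.
split=> [/(@nbhs_normP R 'rV[R]_d)[e /= e0 eA]|[e e0 eA]].
  exists e => // y xy; apply: eA; rewrite /ball_/= distrC.
  exact: le_lt_trans (ler_norm_enorm _) xy.
(* The constant d + 1 keeps the radius positive when d = 0. *)
apply/(@nbhs_normP R 'rV[R]_d); exists (e / (d%:R + 1)).
  by rewrite /= divr_gt0.
move=> y; rewrite /ball_/= ltr_pdivlMr// distrC => xy; apply: eA.
apply: le_lt_trans (ler_enorm_norm _) _; apply: le_lt_trans xy.
by rewrite mulrC ler_wpM2l// lerDl.
Qed.

Lemma ler_enorm_lip x y : `|enorm x - enorm y| <= enorm (x - y).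
Proof.
have lip (u v : 'rV[R]_d) : enorm u - enorm v <= enorm (u - v).
  by have := ler_enormD (u - v) v; rewrite subrK lerBlDr.
by rewrite ler_norml lip andbT lerNl opprB enormC lip.
Qed.

Lemma continuous_enorm_dist x : continuous (fun y : 'rV[R]_d => enorm (x - y)).
Proof.
move=> y; apply/(cvgrPdist_lt (F := nbhs y)) => e e0.
apply/nbhs_enormP; exists e => // z yz.
apply: le_lt_trans (ler_enorm_lip _ _) _.
by rewrite opprB addrC addrA subrK.
Qed.

Lemma closure_enormP (A : set 'rV[R]_d) x :
  closure A x <-> forall e, 0 < e -> exists2 y, A y & enorm (x - y) < e.
Proof.
split=> [Ax e e0|Ax B].
  have /(Ax _)[y [Ay xy]] : nbhs x (eball x e) by apply/nbhs_enormP; exists e.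
  by exists y => //; rewrite enormC.
move=> /nbhs_enormP[e e0 eB]; have [y Ay xy] := Ax _ e0.
by exists y; split=> //; apply: eB; rewrite /eball/= enormC.
Qed.

End Euclidean.

(** Written through [proj], so that the closest point entering the distance is the one in the drift
    inner product. *)
Definition cdist (R : realType) (d : nat) (D : set 'rV[R]_d) (y : 'rV[R]_d) : R :=
  enorm (y - proj D y).

Section ClosestPoint.
Variables (R : realType) (d : nat) (D : set 'rV[R]_d).
Hypotheses (D0 : D !=set0) (Dc : compact (closure D)).
Implicit Types x y : 'rV[R]_d.

(** The distance attains its minimum on the compact closure, so [proj] never takes the default value
    of [xget]. *)
Lemma projP x : closure D (proj D x) /\
  forall w, closure D w -> cdist D x <= enorm (x - w).
Proof.
rewrite /cdist /proj; case: xgetP => [z _ //|/(_ _) no].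
have cx : {within closure D, continuous (fun w : 'rV[R]_d => enorm (x - w))}.
  by apply: continuous_subspaceT; exact: continuous_enorm_dist.
have [|c] := compact_EVT_min _ Dc cx.
  by case: D0 => a Da; exists a; exact: subset_closure.
rewrite inE => Dc' cmin; case: (no c); split=> // w Dw.
by apply: cmin; rewrite inE.
Qed.

Lemma cdist_le x w : closure D w -> cdist D x <= enorm (x - w).
Proof. by case: (projP x) => _; exact. Qed.

Lemma cdist_ge0 x : 0 <= cdist D x.
Proof. exact: enorm_ge0. Qed.

Lemma cdist_lip x y : cdist D x <= cdist D y + enorm (x - y).
Proof.
have := ler_enorm_dist x y (proj D y).
by move=> h; have := cdist_le x (projP y).1; rewrite -/(cdist D y) in h *; lra.

Qed.

Lemma cdist_eq0 x : cdist D x = 0 <-> closure D x.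
Proof.
split=> [/eqP|Dx].
  by rewrite enorm_eq0 subr_eq0 => /eqP ->; exact: (projP x).1.
apply/le_anti; rewrite cdist_ge0 andbT.
by have := cdist_le x Dx; rewrite subrr enorm0.
Qed.

Lemma proj_id x : closure D x -> proj D x = x.
Proof.
by move=> /cdist_eq0/eqP; rewrite enorm_eq0 subr_eq0 => /eqP.
Qed.

Lemma cdist_gt0 x : ~ closure D x -> 0 < cdist D x.
Proof.
by move=> Dx; rewrite lt_def cdist_ge0 andbT; apply/eqP => /cdist_eq0.
Qed.

Lemma cdist_le_edist x : cdist D x <= edist D x.
Proof.
apply: lb_le_inf; first by case: D0 => a Da; exists (enorm (x - a)), a.
by move=> _ [a Da <-]; apply: cdist_le; exact: subset_closure.
Qed.

Lemma edist_closure x : closure D x -> edist D x <= 0.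
Proof.
move=> /closure_enormP Dx; apply/ler_addgt0Pr => e e0; rewrite add0r.
have [a Da xa] := Dx _ e0; apply: le_trans (ltW xa).
apply: ge_inf; last by exists a.
by exists 0 => _ [b _ <-]; exact: enorm_ge0.
Qed.

End ClosestPoint.

(** * Sequential Arzela-Ascoli *)

(** The closed ball of radius [C] is compact, so [u] has a cluster point along [G], and a cluster
    point of an ultrafilter is a limit. *)
Lemma ultra_limit (R : realType) (d : nat) (T : Type) (G : set_system T)
    (u : T -> 'rV[R]_d) (C : R) :
  UltraFilter G -> G [set n | enorm (u n) <= C] ->
  exists p, forall e, 0 < e -> G [set n | enorm (u n - p) < e].
Proof.
move=> GU GC; have GP : ProperFilter G := @ultra_proper _ _ GU.
have : compact [set v : 'rV[R]_d | enorm (0 - v) <= C].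
  apply: bounded_closed_compact.
    exists C; split; first exact: num_real.
    move=> M CM v /=; rewrite sub0r enormN => vC.
    by apply: le_trans (ler_norm_enorm _) _; apply: le_trans vC (ltW CM).
  apply: (@preimage_closed _ _ (fun v : 'rV[R]_d => enorm (0 - v)) [set r | r <= C]).
    by move=> v _; exact: continuous_enorm_dist.
  exact: closed_le.
move=> cC; have uP : ProperFilter (u @ G) by exact: fmap_proper_filter.
have [|p [_ Gp]] := cC (u @ G) uP.
  by rewrite /fmap/=; apply: filterS GC => n /=; rewrite sub0r enormN.
exists p => e e0.
have [//|GN] := in_ultra_setVsetC [set n | enorm (u n - p) < e] GU.
have pe : nbhs p (eball p e) by apply/nbhs_enormP; exists e.
have /Gp/(_ pe)[v [nv pv]] : (u @ G) (~` eball p e) by [].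
by case: (nv pv).
Qed.

(** Each index is picked beyond the preceding one, which gives strict monotonicity and membership at
    once. *)
Lemma sparse_subsequence (P : nat -> set nat) :
  (forall k N, exists2 n, (N <= n)%N & P k n) ->
  exists2 m : nat -> nat, {homo m : a b / (a < b)%N} & forall k, P k (m k).
Proof.
move=> inf.
have /choice[f fP] (kN : nat * nat) : exists n, (kN.2 <= n)%N /\ P kN.1 n.
  by have [n] := inf kN.1 kN.2; exists n.
pose m := fix m k := if k is k'.+1 then f (k, (m k').+1) else f (0%N, 0%N).
exists m.
  by apply: homo_ltn => [a b c|i]; [exact: ltn_trans|exact: (fP (_, _)).1].
by case=> [|k]; exact: (fP (_, _)).2.
Qed.

Section Ascoli.
Variables (R : realType) (d : nat) (g : nat -> R -> 'rV[R]_d) (B : set nat).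
Variables (C V L : R).
Hypotheses (V0 : 0 <= V) (L0 : 0 <= L).
Hypothesis Binf : forall N, exists2 n, (N <= n)%N & B n.
Hypothesis g0 : forall n, B n -> enorm (g n 0) <= C.
Hypothesis glip : forall n s t, B n -> 0 <= s -> 0 <= t ->
  enorm (g n s - g n t) <= V * `|s - t|.
Hypothesis gL : forall n t, B n -> L <= t -> g n t = g n L.

(* The limit is taken along an ultrafilter containing [B] and all the tails, so
   that no diagonal extraction is needed before the end. *)
Lemma ascoli_subsequence : exists (m : nat -> nat) (y : R -> 'rV[R]_d),
  [/\ {homo m : a b / (a < b)%N}, forall n, B (m n),
      forall s t, 0 <= s -> 0 <= t -> enorm (y s - y t) <= V * `|s - t| &
      forall e, 0 < e -> \forall n \near \oo,
        forall t, 0 <= t -> enorm (g (m n) t - y t) < e].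
Proof.
have wP : ProperFilter (within B \oo).
  apply: Build_ProperFilter_ex => A [N _ NA].
  by have [n Nn Bn] := Binf N; exists n; exact: NA.
have [G [GU wG]] := ultraFilterLemma wP.
have GP : ProperFilter G := @ultra_proper _ _ GU.
have GB : G B by apply: wG; exact: withinT.
have /choice[y yP] (t : R) : exists p, 0 <= t ->
    forall e, 0 < e -> G [set n | enorm (g n t - p) < e].
  have [t0|_] := leP 0 t; last by exists 0.
  have [|p pP] := @ultra_limit R d nat G (fun n => g n t) (C + V * t) GU.
    apply: filterS GB => n Bn /=; rewrite -[g n t](subrK (g n 0)) addrC.
    apply: le_trans (ler_enormD _ _) _; apply: lerD; first exact: g0.
    by apply: le_trans (glip _ _ _) _ => //; rewrite subr0 ger0_norm.
  by exists p.
(* Inequalities between two values of the [g n] survive in the limit: sets of [G] intersect, so one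
   index serves both points. *)
have close s t a : 0 <= s -> 0 <= t ->
    (forall n, B n -> enorm (g n s - g n t) <= a) -> enorm (y s - y t) <= a.
  move=> s0 t0 ga; apply/ler_addgt0Pr => e e0.
  have e20 : 0 < e / 2 by rewrite divr_gt0.
  have [n [Bn /= [h1 h2]]] :=
    filter_ex (filterI GB (filterI (yP s s0 _ e20) (yP t t0 _ e20))).
  have := ler_enorm_dist (y s) (g n s) (y t).
  have := ler_enorm_dist (g n s) (g n t) (y t).
  by have := ga n Bn; move: h1 h2; rewrite (enormC (y s) (g n s)); lra.
have ylip s t : 0 <= s -> 0 <= t -> enorm (y s - y t) <= V * `|s - t|.
  by move=> s0 t0; apply: close => // n Bn; exact: glip.
have yL t : L <= t -> y t = y L.
  move=> Lt; apply/eqP; rewrite -subr_eq0 -enorm_eq0; apply/eqP/le_anti.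
  rewrite enorm_ge0 andbT; apply: close => //; first exact: le_trans Lt.
  by move=> n Bn; rewrite gL// subrr enorm0.
(* Pointwise convergence becomes uniform: by the common Lipschitz bound a finite grid of mesh h with
   V h <= e/3 suffices, and past [L] all functions are constant. *)
have unif e : 0 < e -> G [set n | forall t, 0 <= t -> enorm (g n t - y t) < e].
  move=> e0; pose h := e / 3 / (V + 1).
  have V1 : 0 < V + 1 by rewrite ltr_wpDl.
  have h0 : 0 < h by rewrite !divr_gt0.
  have Vh : V * h <= e / 3.
    rewrite /h mulrCA -[leRHS]mulr1 ler_wpM2l ?divr_ge0 ?(ltW e0)//.
    by rewrite ler_pdivrMr// mul1r lerDl.
  have e3 : 0 < e / 3 by rewrite divr_gt0.
  pose J := (Num.trunc (L / h)).+1.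
  have hj0 j : 0 <= h * j%:R by rewrite mulr_ge0// ltW.
  have /= Gfin := @filter_forall nat 'I_J _ _ GP (fun j => yP _ (hj0 j) _ e3).
  apply: filterS (filterI GB Gfin) => n [Bn /= gj].
  suff small t : 0 <= t <= L -> enorm (g n t - y t) < e.
    move=> t t0; have [tL|Lt] := leP t L; first by apply: small; rewrite t0.
    by rewrite gL ?yL// ?ltW// small// lexx L0.
  move=> /andP[t0 tL].
  have /andP[j1 j2] := truncn_itv (divr_ge0 t0 (ltW h0)).
  set j := Num.trunc _ in j1 j2.
  have jJ : (j < J)%N.
    rewrite ltnS /j; apply: le_truncn.
    by rewrite ler_pM2r ?invr_gt0.
  move: j1; rewrite ler_pdivlMr// mulrC => j1.
  move: j2; rewrite ltr_pdivrMr// mulrC -natr1 mulrDr mulr1 => j2.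
  have tj : V * `|t - h * j%:R| <= e / 3.
    apply: le_trans Vh; apply: ler_wpM2l => //.
    by rewrite ger0_norm ?subr_ge0//; move: j2; lra.
  have := gj (Ordinal jJ) => /=.
  have := glip Bn t0 (hj0 j); have := ylip _ _ (hj0 j) t0; rewrite (distrC _ t).
  have := ler_enorm_dist (g n t) (g n (h * j%:R)) (y t).
  have := ler_enorm_dist (g n (h * j%:R)) (y (h * j%:R)) (y t).
  by move: tj; lra.
(* Every set of [G] meets every tail, so indices with error below 1/(k+1) exist arbitrarily far
   out. *)
have [|m mlt mP] := @sparse_subsequence
    (fun k => [set n | B n /\ forall t, 0 <= t -> enorm (g n t - y t) < k.+1%:R^-1]).
  move=> k N; have GN : G [set n | (N <= n)%N].
    by apply: wG; exists N.
  have k0 : 0 < k.+1%:R^-1 :> R by rewrite invr_gt0.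
  have [n [Nn [Bn gy]]] := filter_ex (filterI GN (filterI GB (unif _ k0))).
  by exists n.
exists m, y; split=> // [n|e e0]; first by case: (mP n).
have := @near_infty_natSinv_lt R (PosNum e0).
apply: filterS => n /= ne t t0; apply: lt_trans ne; exact: (mP n).2.
Qed.

End Ascoli.

(** * Interpolated trajectories and switching times *)

Section Clock.
Variable R : realType.

Lemma clock0 : clock R 0 = 0.
Proof. by rewrite /clock big_geq. Qed.

Lemma clockS n : clock R n.+1 = clock R n + n.+1%:R^-1.
Proof. by rewrite /clock big_nat_recr. Qed.

Lemma lt_clockS n : clock R n < clock R n.+1.
Proof. by rewrite clockS ltrDl invr_gt0. Qed.

Lemma ltr_clock : {homo clock R : m n / (m < n)%N >-> m < n}.
Proof. by apply: homo_ltn lt_clockS => a b c; exact: lt_trans. Qed.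

Lemma ler_clock : {homo clock R : m n / (m <= n)%N >-> m <= n}.
Proof.
by apply: homo_leq => [//|a b c|n]; [exact: le_trans|exact: ltW (lt_clockS n)].
Qed.

(** A bounded clock would be a convergent nondecreasing sequence, against the divergence of the
    harmonic series. *)
Lemma clock_unbounded (t : R) : exists n, t < clock R n.
Proof.
apply: contrapT => /forallNP no; apply: (@dvg_harmonic R).
have sE : series (@harmonic R) = clock R.
  by apply/funext => n; rewrite /series/= /clock big_add1.
apply: nondecreasing_is_cvgn.
  by rewrite sE => m n mn; exact: ler_clock.
exists t => _ [n _ <-]; rewrite sE leNgt; exact/negP/no.
Qed.

Lemma clock_cell (t : R) : 0 <= t -> exists n, clock R n <= t < clock R n.+1.
Proof.
move=> t0; have ex := clock_unbounded t; case: (ex_minnP ex) => -[|n] tn nmin.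
  by move: tn; rewrite clock0 ltNge t0.
exists n; rewrite tn andbT leNgt; apply/negP => /nmin; by rewrite ltnn.
Qed.

Lemma clock_cell_uniq (t : R) m n : clock R m <= t < clock R m.+1 ->
  clock R n <= t < clock R n.+1 -> m = n.
Proof.
move=> /andP[m1 m2] /andP[n1 n2]; apply/eqP; rewrite eqn_leq.
apply/andP; split; rewrite leqNgt; apply/negP => /ler_clock h.
  by have := le_lt_trans (le_trans h m1) n2; rewrite ltxx.
by have := le_lt_trans (le_trans h n1) m2; rewrite ltxx.
Qed.

End Clock.

Section Interpolation.
Variables (R : realType) (d : nat) (x : nat -> 'rV[R]_d) (V : R).
Hypothesis xstep : forall n, enorm (x n.+1 - x n) <= V * n.+1%:R^-1.

Lemma xbar_cell n t : clock R n <= t <= clock R n.+1 ->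
  xbar x t = x n + ((t - clock R n) * n.+1%:R) *: (x n.+1 - x n).
Proof.
have xbarE m : clock R m <= t < clock R m.+1 ->
    xbar x t = x m + ((t - clock R m) * m.+1%:R) *: (x m.+1 - x m).
  move=> tm; rewrite /xbar; set k := xget _ _.
  have km : k = m.
    apply: (clock_cell_uniq _ tm); rewrite /k; case: xgetP => [y _ //|no].
    by case: (no m tm).
  by rewrite km clockS addrAC subrr add0r invrK.
(* At the right end point the definition already uses cell n + 1; both formulas give [x n.+1]
   there. *)
move=> /andP[t1]; rewrite le_eqVlt => /orP[/eqP tE|t2]; last first.
  by apply: xbarE; rewrite t1.
rewrite (xbarE n.+1) ?tE ?lexx ?lt_clockS// subrr mul0r scale0r addr0.
by rewrite clockS addrAC subrr add0r mulVf// scale1r addrC subrK.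
Qed.

Lemma xbar_clock n : xbar x (clock R n) = x n.
Proof.
rewrite (@xbar_cell n) ?lexx ?ltW ?lt_clockS//.
by rewrite subrr mul0r scale0r addr0.
Qed.

(** The slope on a cell is (n+1)(x_{n+1} - x_n), whose norm [xstep] bounds by [V]. *)
Lemma xbar_lip_cell n s t : clock R n <= s -> s <= t -> t <= clock R n.+1 ->
  enorm (xbar x t - xbar x s) <= V * (t - s).
Proof.
move=> ns st tn.
rewrite (@xbar_cell n t) ?tn ?(le_trans ns)//.
rewrite (@xbar_cell n s) ?ns ?(le_trans st)//.
rewrite opprD addrACA subrr add0r -scalerBl -mulrBl enormZ.
rewrite [t - _ - _](_ : _ = t - s); last by ring.
rewrite ger0_norm ?mulr_ge0 ?subr_ge0// -mulrA [leRHS]mulrC.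
by rewrite ler_wpM2l ?subr_ge0// mulrC -ler_pdivlMr.
Qed.

Lemma dist_clock m n : (m <= n)%N ->
  enorm (x n - x m) <= V * (clock R n - clock R m).
Proof.
elim: n => [|n IHn]; first by rewrite leqn0 => /eqP->; rewrite !subrr enorm0 mulr0.
rewrite leq_eqVlt => /orP[/eqP->|mn]; first by rewrite !subrr enorm0 mulr0.
apply: le_trans (ler_enorm_dist _ (x n) _) _.
rewrite clockS [_ + n.+1%:R^-1]addrC -addrA mulrDr.
by apply: lerD; [exact: xstep|exact: IHn].
Qed.

Lemma xbar_lip s t : 0 <= s -> s <= t -> enorm (xbar x t - xbar x s) <= V * (t - s).
Proof.
move=> s0 st; have [m /andP[m1 m2]] := clock_cell s0.
have [n /andP[n1 n2]] := clock_cell (le_trans s0 st).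
have [mn|nm] := ltnP m n; last first.
  apply: (@xbar_lip_cell m) => //; apply: le_trans (ltW n2) _.
  exact: ler_clock.
have h1 : enorm (xbar x (clock R m.+1) - xbar x s) <= V * (clock R m.+1 - s).
  by apply: (@xbar_lip_cell m) => //; exact: ltW.
have h2 : enorm (xbar x t - xbar x (clock R n)) <= V * (t - clock R n).
  by apply: (@xbar_lip_cell n) => //; exact: ltW.
have := dist_clock mn; rewrite !xbar_clock in h1 h2 => h3.
have := ler_enorm_dist (xbar x t) (x n) (xbar x s).
have := ler_enorm_dist (x n) (x m.+1) (xbar x s).
by move: h1 h2 h3; rewrite !mulrBr; lra.
Qed.

End Interpolation.

Section Switching.
Variables (R : realType) (d : nat) (St Up Ua : finType).
Variables (M : setting R d St Up Ua) (x : nat -> 'rV[R]_d).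
Hypothesis durM : forall n, off_target M (x n) -> 0 < dur M (Qpt M (x n)).

Let elapsed s m : \bar R := (\sum_(s <= i < m) ((i%:R)%:E)^-1)%E.

(** The sum runs over s <= i < m while the clock increment runs over s < i <= m, whence the
    correction 1/s - 1/m. *)
Lemma elapsedE s m : (0 < s <= m)%N ->
  elapsed s m = (clock R m - clock R s + s%:R^-1 - m%:R^-1)%:E.
Proof.
move=> /andP[s0 sm]; rewrite /elapsed.
under eq_big_nat => i /andP[si _].
  rewrite inver pnatr_eq0 gtn_eqF ?(leq_trans s0)//.
over.
rewrite sumEFin; congr (_%:E).
case: s s0 sm => // s _; case: m => // m sm.
rewrite !clockS /clock (@big_cat_nat _ _ _ s.+1 1 m.+1)//=.
by ring.
Qed.

Lemma next_switchP s : off_target M (x s) ->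
  let Tq := (dur M (Qpt M (x s)))%:E in
  (0 < s)%N -> [/\ (s < next_switch M x s)%N,
  (Tq < elapsed s (next_switch M x s))%E &
  (elapsed s (next_switch M x s).-1 <= Tq)%E].
Proof.
move=> ofs Tq s0; rewrite /next_switch asboolT//; set m := xget _ _.
have [m1 m2] : (Tq < elapsed s m)%E /\
    forall m', (Tq < elapsed s m')%E -> (m <= m')%N.
  rewrite /m; case: xgetP => [m' _ //|no]; exfalso.
  (* The clock is unbounded, so the threshold is exceeded and the default of [xget] does not
     occur. *)
  have ex : exists m', (Tq < elapsed s m')%E.
    have [n nT] := clock_unbounded (dur M (Qpt M (x s)) + clock R s).
    exists (n + s)%N; rewrite elapsedE ?s0 ?leq_addl// lte_fin.
    have := @ler_clock R n (n + s) (leq_addr _ _).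
    have : (n + s)%:R^-1 <= s%:R^-1 :> R.
      by rewrite lef_pV2 ?posrE ?ltr0n ?addn_gt0 ?s0 ?orbT// ler_nat leq_addl.
    by move: nT; lra.
  by case: (ex_minnP ex) => m' h1 h2; exact: (no m').
have sm : (s < m)%N.
  rewrite ltnNge; apply/negP => ms; move: m1; rewrite /elapsed big_geq//.
  by rewrite lte_fin ltNge ltW ?durM.
split=> //; rewrite leNgt; apply/negP => /m2.
by case: (m) sm => // k _; rewrite ltnn.
Qed.

Lemma next_switch_gt s : (s < next_switch M x s)%N.
Proof.
(* At s = 0 the sum may contain 1/0 and [elapsedE] does not apply; positivity of the duration
   excludes the empty sum. *)
have [->|s0] := posnP s.
  rewrite /next_switch; case: asboolP => // of0.
  case: xgetP => // -[_ [h _]|//]; move: h.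
  by rewrite big_geq// lte_fin ltNge ltW ?durM.
have [ofs|nof] := pselect (off_target M (x s)); first by case: (next_switchP ofs s0).
by rewrite /next_switch asboolF.
Qed.

(** If m + 1 is the next switch, minimality puts the difference between 1/(m+1) - 1/s and 1/m +
    1/(m+1) - 1/s, and m >= s. *)
Lemma next_switch_clock s : off_target M (x s) -> (0 < s)%N ->
  `|clock R (next_switch M x s) - clock R s - dur M (Qpt M (x s))| <= s%:R^-1.
Proof.
move=> ofs s0; have [] := next_switchP ofs s0.
case: (next_switch M x s) => // m sm /=; rewrite ltnS in sm.
rewrite !elapsedE ?s0//; last exact: leqW.
rewrite lte_fin lee_fin clockS => h1 h2.
have ms k : (s <= k)%N -> k%:R^-1 <= s%:R^-1 :> R.
  by move=> sk; rewrite lef_pV2 ?posrE ?ltr0n ?(leq_trans s0)// ler_nat.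
have := ms m sm; have := ms m.+1 (leqW sm).
have i0 k : 0 <= k%:R^-1 :> R by rewrite invr_ge0.
have := i0 m; have := i0 m.+1; rewrite ler_norml.
move: h1 h2; set a := m.+1%:R^-1; set b := m%:R^-1; set c := s%:R^-1.
by move=> h1 h2 a0 b0 ac bc; apply/andP; split; lra.
Qed.

Lemma next_switch_off s : ~ off_target M (x s) -> next_switch M x s = s.+1.
Proof. by move=> nof; rewrite /next_switch asboolF. Qed.

Lemma switch_gt l : (switch M x l < switch M x l.+1)%N.
Proof. exact: next_switch_gt. Qed.

Lemma leq_switch l : (l <= switch M x l)%N.
Proof. by elim: l => // l IHl; exact: leq_ltn_trans IHl (switch_gt l). Qed.

Lemma homo_switch : {homo switch M x : k l / (k <= l)%N}.
Proof.
apply: homo_leq => [//|a b c|l]; [exact: leq_trans|exact: ltnW (switch_gt l)].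
Qed.

Lemma switch_cell i : exists l, (switch M x l <= i < switch M x l.+1)%N.
Proof.
have ex : exists l, (i < switch M x l)%N by exists i.+1; exact: leq_switch.
case: (ex_minnP ex) => -[//|l] il lmin; exists l; rewrite il andbT leqNgt.
by apply/negP => /lmin; rewrite ltnn.
Qed.

(** Displays [ybar] as [xbar] stopped at the end of the switching interval, so that it inherits the
    Lipschitz bound. *)
Lemma ybarE l t : ybar M x l t =
  xbar x (clock R (switch M x l) +
          Num.min t (clock R (switch M x l.+1) - clock R (switch M x l))).
Proof.
by rewrite /ybar; case: leP => // _; rewrite addrC subrK.
Qed.

Variable V : R.
Hypothesis xstep : forall n, enorm (x n.+1 - x n) <= V * n.+1%:R^-1.

Lemma ybar0 l : ybar M x l 0 = x (switch M x l).
Proof.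
rewrite ybarE; case: leP => [_|].
  by rewrite addr0 xbar_clock.
by rewrite ltNge subr_ge0 ltW ?ltr_clock ?switch_gt.
Qed.

Lemma ybar_lip l s t : 0 <= s -> 0 <= t ->
  enorm (ybar M x l s - ybar M x l t) <= V * `|s - t|.
Proof.
have V0 : 0 <= V by have := le_trans (enorm_ge0 _) (xstep 0); rewrite invr1 mulr1.
have c0 n : 0 <= clock R n by rewrite -[leLHS]clock0; exact: ler_clock.
have D0 : 0 <= clock R (switch M x l.+1) - clock R (switch M x l).
  by rewrite subr_ge0 ltW ?ltr_clock ?switch_gt.
suff lip s' t' : 0 <= s' -> s' <= t' ->
    enorm (ybar M x l t' - ybar M x l s') <= V * (t' - s').
  move=> s0 t0; have [st|ts] := leP s t.
    by rewrite enormC distrC ger0_norm ?subr_ge0//; exact: lip.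
  by rewrite ger0_norm ?subr_ge0 ?(ltW ts)//; apply: lip => //; exact: ltW.
move=> s0 st; rewrite !ybarE; set D := (X in Num.min _ X) in D0 *.
have minst : Num.min s' D <= Num.min t' D by rewrite le_min !ge_min st lexx orbT.
apply: le_trans (xbar_lip xstep _ _) _.
- by rewrite addr_ge0// le_min s0.
- by rewrite lerD2l.
apply: ler_wpM2l => //; rewrite opprD addrACA subrr add0r.
by case: (leP s' D) (leP t' D) => [?|?] [?|?]; lra.
Qed.

End Switching.

(** * Drift towards the target *)

(** Blackwell's estimate: with p the closest point to a, bound the distance of b by |b - p| and
    expand around a - p. Splitting k - a = (k - p) - (a - p) produces a term -2 lam |a - p|^2, which
    is dropped. *)
Lemma sqr_cdist_step (R : realType) (d : nat) (D : set 'rV[R]_d)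
    (D0 : D !=set0) (Dc : compact (closure D)) (a b k : 'rV[R]_d) (lam c : R) :
  0 <= lam -> b - a = lam *: (k - a) ->
  c <= dotp (k - proj D a) (proj D a - a) ->
  cdist D b ^+ 2 <= cdist D a ^+ 2 - 2 * lam * c + enorm (b - a) ^+ 2.
Proof.
move=> lam0 ba ck; apply: (@le_trans _ _ (enorm (b - proj D a) ^+ 2)).
  have h := cdist_le D0 Dc b (projP D0 Dc a).1.
  by rewrite !expr2; apply: ler_pM; rewrite ?cdist_ge0.
rewrite /cdist; set p := proj D a in ck *.
have -> : b - p = (b - a) + (a - p) by rewrite addrA subrK.
rewrite enormD_sqr {2}ba dotpZl.
have -> : k - a = (k - p) - (a - p) by rewrite opprB addrA subrK.
rewrite dotpBl.
have := ler_wpM2l lam0 ck; rewrite -(opprB a p) dotpNr.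
have := mulr_ge0 lam0 (dotp_ge0 (a - p)).
lra.
Qed.

(** From exp h >= 1 + h one gets 1 - exp(-h) >= h/(1+h), which is at least h/2 on [0,1]. *)
Lemma expRN_small (R : realType) (h : R) : 0 <= h <= 1 -> h / 2 <= 1 - expR (- h).
Proof.
move=> /andP[h0 h1]; rewrite expRN.
have e1 := expR_ge1Dx h.
have ep : 0 < 1 + h by rewrite ltr_pwDl.
have : (expR h)^-1 <= (1 + h)^-1 by rewrite lef_pV2 ?posrE ?expR_gt0.
suff : (1 + h)^-1 <= 1 - h / 2 by lra.
rewrite -[leLHS]mul1r ler_pdivrMr//; nra.
Qed.

(** * Discretization points and uniform drift *)

Section Model.
Variables (R : realType) (d : nat) (St Up Ua : finType).
Variables (M : setting R d St Up Ua) (HM : standing_assumptions M).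
Let D := target M.

Lemma Kset_closed : closed (Kset M).
Proof. by apply: compact_closed (Kset_compact HM); exact: norm_hausdorff. Qed.

Lemma closure_target_sub : closure D `<=` Kset M.
Proof.
move=> z Dz; apply: Kset_closed; apply: closure_subset Dz; exact: target_sub HM.
Qed.

Lemma closure_target_compact : compact (closure D).
Proof.
apply: subclosed_compact (Kset_compact HM) closure_target_sub.
exact: closed_closure.
Qed.

Let D0 : D !=set0 := target_nonempty HM.
Let Dc := closure_target_compact.

Lemma Kset_bounded : exists C, forall z, Kset M z -> enorm z <= C.
Proof.
have [N [_ NK]] := compact_bounded (Kset_compact HM).
exists (d%:R * (N + 1)) => z Kz; apply: le_trans (ler_enorm_norm _) _.
by rewrite ler_wpM2l//; apply: NK => //; rewrite ltrDl.
Qed.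

Lemma edist_gt0 y : ~ closure D y -> 0 < edist D y.
Proof. by move=> /(cdist_gt0 D0 Dc)/lt_le_trans; apply; exact: cdist_le_edist. Qed.

(** The shell is n = floor(1/edist), or 0 when the distance is at least 1; the bound on n leaves
    finitely many shells for points at distance at least e. *)
Lemma shell_exists e y : 0 < e -> Kset M y -> e <= edist D y ->
  exists2 n, (n <= Num.trunc e^-1)%N & shell M n y.
Proof.
move=> e0 Ky ey; have y0 := lt_le_trans e0 ey.
have [y1|y1] := leP 1 (edist D y); first by exists 0%N.
have V1 : 1 <= (edist D y)^-1 by rewrite invf_ge1// ltW.
have /andP[n1 n2] := truncn_itv (le_trans ler01 V1).
exists (Num.trunc (edist D y)^-1).
  by apply: Num.Theory.le_truncn; rewrite lef_pV2.
have : (0 < Num.trunc (edist D y)^-1)%N by rewrite truncn_gt0.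
move: n1 n2; case: (Num.trunc _) => // n n1 n2 _; split=> //.
rewrite -/D -[X in _ <= X <= _]invrK !lef_pV2 ?posrE ?invr_gt0//.
by rewrite n1 ltW.
Qed.

Lemma off_target_cdist y : off_target M y -> 0 < cdist D y.
Proof. by move=> [_]; exact: cdist_gt0. Qed.

Lemma Qset_off_target q : Qset M q -> off_target M q.
Proof.
move=> [n _ /(Qn_sub HM) qn]; have [Kq eq] : Kset M q /\ 0 < edist D q.
  case: n qn => [|n] [Kq qn]; split=> //; first exact: lt_le_trans qn.
  by case/andP: qn => qn _; apply: lt_le_trans qn; rewrite invr_gt0.
split=> // /edist_closure; rewrite leNgt; exact/negP/negPn.
Qed.

Lemma Qset_cover y : off_target M y ->
  exists2 q, Qset M q & eball q (rho M q / 2) y.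
Proof.
move=> [Ky Dy]; have y0 := edist_gt0 Dy.
have [n _ /(Qn_cover HM)[q qn yq]] := shell_exists y0 Ky (lexx _).
by exists q => //; exists n.
Qed.

(** The cover provides a candidate and well-ordering one of least index, so the default value in
    [Qpt] does not occur. *)
Lemma QptP y : off_target M y -> [/\ Qset M (Qpt M y),
  eball (Qpt M y) (rho M (Qpt M y) / 2) y &
  forall q, Qset M q -> eball q (rho M q / 2) y -> (idx M (Qpt M y) <= idx M q)%N].
Proof.
move=> yoff; rewrite /Qpt; case: xgetP => [_ _ //|no]; exfalso.
have ex : exists n,
    `[< exists q, [/\ Qset M q, eball q (rho M q / 2) y & idx M q = n] >].
  by have [q qQ yq] := Qset_cover yoff; exists (idx M q); apply/asboolP; exists q.
case: (ex_minnP ex) => n /asboolP[q [qQ yq qn]] nmin.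
apply: (no q); split=> // q' q'Q yq'; rewrite qn; apply: nmin.
by apply/asboolP; exists q'.
Qed.

Lemma dur_Qpt_gt0 y : off_target M y -> 0 < dur M (Qpt M y).
Proof. by move=> /QptP[Qy _ _]; exact: dur_gt0 HM _ Qy. Qed.

(** A positive real below the extended infimum of [rho_drift] works for the rewards themselves; the
    bound extends to their closure because the inner product is continuous in k. *)
Lemma rewards_drift q : Qset M q -> exists2 c, 0 < c &
  forall y k, eball q (rho M q) y -> closure (rewards M (strat M q)) k ->
    c <= dotp (k - proj D y) (proj D y - y).
Proof.
move=> /Qset_off_target/(rho_drift HM) dr.
have [c c0 cdr] : exists2 c : R, 0 < c &
    (c%:E <= ereal_inf [set drift M (strat M q) y | y in eball q (rho M q)])%E.
  case: (ereal_inf _) dr => [r|_|//]; first by rewrite lte_fin => r0; exists r.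
  by exists 1 => //; rewrite leey.
exists c => // y k yq.
move=> /closure_enormP kcl; set v := proj D y - y.
apply/ler_addgt0Pr => e e0; have v1 : 0 < enorm v + 1 by rewrite ltr_wpDl ?enorm_ge0.
have [_ [pia sp <-] kk] := kcl _ (divr_gt0 e0 v1); set k' := kbar _ _ _ in kk.
have ck' : c <= dotp (k' - proj D y) v.
  rewrite -lee_fin; apply: le_trans cdr _.
  apply: (@le_trans _ _ (drift M (strat M q) y)).
    by apply: ereal_inf_lbound; exists y.
  by apply: ereal_inf_lbound; exists pia.
apply: le_trans ck' _; rewrite -lerBlDl -dotpBl opprB addrA subrK.
apply: le_trans (dotp_le_enorm _ _) _; rewrite enormC.
apply: (@le_trans _ _ (e / (enorm v + 1) * (enorm v + 1))); last first.
  by rewrite divfK ?gt_eqF.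
by apply: ler_pM; rewrite ?enorm_ge0 ?lerDl// ltW.
Qed.

End Model.

(** * Descent along one limit trajectory *)

Section Trajectory.
Variables (R : realType) (d : nat) (St Up Ua : finType).
Variables (M : setting R d St Up Ua) (HM : standing_assumptions M).
Let D := target M.
Let D0 : D !=set0 := target_nonempty HM.
Let Dc : compact (closure D) := closure_target_compact HM.

(** [kappa_jk] is the constant input that drives y' = kappa - y from y(hj) to y(h(j+1)) in time h;
    the difference form feeds [sqr_cdist_step] with weight 1 - exp(-h). *)
Lemma kappa_jkE (T : R) j k (y : R -> 'rV[R]_d) :
  let h := 2 ^- k * T in 0 < h ->
  y (h * j.+1%:R) - y (h * j%:R) =
  (1 - expR (- h)) *: (kappa_jk T j k y - y (h * j%:R)).
Proof.
move=> h h0; have e1 : 1 - expR (- h) != 0.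
  by rewrite subr_eq0 gt_eqF// expR_lt1 oppr_lt0.
rewrite scalerBr /kappa_jk -/h scalerA mulfV// scale1r scalerBl scale1r.
by rewrite opprB addrA subrK.
Qed.

Lemma eball_trans q e f y z : enorm (y - q) <= e -> enorm (z - y) <= f ->
  forall g : R, e + f < g -> @eball R d q g z.
Proof.
move=> yq zy g; apply: le_lt_trans; rewrite [leRHS]addrC.
by apply: le_trans (ler_enorm_dist _ y _) (lerD _ _).
Qed.

Variables (q : 'rV[R]_d) (V : R).
Hypotheses (qQ : Qset M q) (V0 : 0 <= V) (VT : V * dur M q < rho M q / 2).

(** Each of the 2^k steps lowers the squared distance by 2(1 - exp(-h)) c >= h c, up to an error (V
    h)^2 <= h c / 2. Since 2^k h = T, the total T c / 2 depends neither on y nor on k. *)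
Lemma limit_trajectory_decrease : exists2 c, 0 < c & forall y : R -> 'rV[R]_d,
  (forall s t, 0 <= s -> 0 <= t -> enorm (y s - y t) <= V * `|s - t|) ->
  enorm (y 0 - q) <= rho M q / 2 ->
  (forall j k, (j < 2 ^ k)%N ->
     closure (rewards M (strat M q)) (kappa_jk (dur M q) j k y)) ->
  cdist D (y (dur M q)) ^+ 2 <= cdist D (y 0) ^+ 2 - c.
Proof.
have descent (u v a i c : R) :
    u <= v - a * i * c / 2 -> u - a * c / 2 <= v - a * (i + 1) * c / 2 by lra.
have [c c0 drf] := rewards_drift HM qQ.
have := VT; have := dur_gt0 HM qQ; set T := dur M q => T0 VT'.
exists (T * c / 2) => [|y ylip y0 yk]; first by rewrite !mulr_gt0 ?invr_gt0.
(* The mesh is chosen so that h (1 + 2 V^2 / c) <= 1, which contains both h <= 1 and h V^2 <= c /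
   2. *)
have [k kT] : exists k, T * (1 + 2 * V ^+ 2 / c) <= 2 ^+ k.
  exists (Num.trunc (T * (1 + 2 * V ^+ 2 / c))).+1.
  have pos : 0 <= T * (1 + 2 * V ^+ 2 / c).
    by rewrite mulr_ge0 ?(ltW T0)// addr_ge0// divr_ge0 ?mulr_ge0 ?sqr_ge0// ltW.
  have /andP[_ /ltW h] := truncn_itv pos; apply: le_trans h _.
  by rewrite -natrX ler_nat ltnW// ltn_expl.
pose h := 2 ^- k * T.
have h0 : 0 < h by rewrite mulr_gt0 ?invr_gt0 ?exprn_gt0.
have hT : h * 2 ^+ k = T by rewrite /h mulrAC mulVf ?mul1r// gt_eqF ?exprn_gt0.
have hk : h * (1 + 2 * V ^+ 2 / c) <= 1.
  by rewrite -(ler_pM2r (exprn_gt0 k (ltr0n R 2))) mul1r mulrAC hT.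
have hV : h * V ^+ 2 <= c / 2 /\ h <= 1.
  have e : h * (1 + 2 * V ^+ 2 / c) = h + 2 / c * (h * V ^+ 2).
    by field; rewrite gt_eqF.
  have p1 : 0 <= 2 / c * (h * V ^+ 2).
    by rewrite !mulr_ge0 ?sqr_ge0 ?invr_ge0// ltW.
  move: hk; rewrite e => hk; split; last by lra.
  rewrite -(ler_pM2l (divr_gt0 (ltr0n R 2) c0)).
  have -> : 2 / c * (c / 2) = 1 by field; rewrite gt_eqF.
  by lra.
have [hV2 h1] := hV.
have step j : (j < 2 ^ k)%N ->
    cdist D (y (h * j.+1%:R)) ^+ 2 <= cdist D (y (h * j%:R)) ^+ 2 - h * c / 2.
  move=> jk; have hj n : 0 <= h * n%:R by rewrite mulr_ge0// ltW.
  have lam : h / 2 <= 1 - expR (- h) by apply: expRN_small; rewrite h1 ltW.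
  apply: le_trans (sqr_cdist_step D0 Dc _ (kappa_jkE _ _ h0) (_ : c <= _)) _.
  - by apply: le_trans lam; rewrite divr_ge0// ltW.
  - apply: drf (yk j k jk).
    (* y(hj) is still in B(q, rho(q)): y(0) is within rho(q)/2 of q and the path has moved by at
       most V T < rho(q)/2. *)
    apply: (eball_trans y0 (ylip _ _ (hj j) (lexx 0))).
    rewrite subr0 ger0_norm// [ltRHS]splitr ltrD2l.
    apply: le_lt_trans VT'; apply: ler_wpM2l => //.
    by rewrite -hT ler_pM2l// -natrX ler_nat ltnW.
  have := ylip _ _ (hj j.+1) (hj j).
  have -> : h * j.+1%:R - h * j%:R = h by rewrite -natr1; ring.
  rewrite ger0_norm ?(ltW h0)// => yh.
  have hV0 : 0 <= h * V by exact: mulr_ge0 (ltW h0) V0.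
  have : enorm (y (h * j.+1%:R) - y (h * j%:R)) ^+ 2 <= h * (h * V ^+ 2).
    rewrite mulrA -expr2 -exprMn lerXn2r ?nnegrE ?enorm_ge0 ?hV0//.
    by rewrite [h * V]mulrC.
  have := ler_wpM2l (ltW h0) hV2; have := ler_wpM2r (ltW c0) lam.
  rewrite -/h; set u := enorm _; set v := expR _.
  by lra.
have iter_step j : (j <= 2 ^ k)%N ->
    cdist D (y (h * j%:R)) ^+ 2 <= cdist D (y 0) ^+ 2 - h * j%:R * c / 2.
  elim: j => [|j IHj] jk; first by rewrite mulr0 !mul0r subr0.
  apply: le_trans (step j jk) _; rewrite -[j.+1%:R]natr1.
  exact: descent (IHj (ltnW jk)).
by have := iter_step _ (leqnn _); rewrite natrX hT.
Qed.

End Trajectory.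

(** * From limit trajectories back to the sequence of averages *)

Lemma enorm_cvg (R : realType) (d : nat) (u : nat -> 'rV[R]_d) (p : 'rV[R]_d) :
  (forall e, 0 < e -> \forall n \near \oo, enorm (u n - p) < e) ->
  u n @[n --> \oo] --> p.
Proof.
move=> up A /nbhs_enormP[e e0 eA].
by have := up e e0; apply: filterS => n /= h; exact: eA.
Qed.

Lemma uniform_enorm_cvg (R : realType) (d : nat) (u : nat -> R -> 'rV[R]_d)
    (y : R -> 'rV[R]_d) (C : set R) :
  (forall e, 0 < e ->
     \forall n \near \oo, forall t, C t -> enorm (u n t - y t) < e) ->
  {uniform C, u @ \oo --> y}.
Proof.
move=> uy A /uniform_nbhs[E [entE EA]].
have [e /= e0 eE] : exists2 e : R, 0 < e &
    [set xy : 'rV[R]_d * 'rV[R]_d | ball xy.1 e xy.2] `<=` E.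
  by move: entE; rewrite -entourage_ballE => -[e e0 eE]; exists e.
have := uy e e0; apply: filterS => n h; apply: EA => t Ct; apply: eE => /=.
rewrite -ball_normE /ball_/= distrC; apply: le_lt_trans (ler_norm_enorm _) _.
exact: h.
Qed.

Lemma within_continuous_enorm_lip (R : realType) (d : nat) (y : R -> 'rV[R]_d)
    (V : R) (A : set R) : 0 <= V ->
  (forall s t, A s -> A t -> enorm (y s - y t) <= V * `|s - t|) ->
  {within A, continuous y}.
Proof.
move=> V0 ylip; apply/subspace_continuousP => s As U /nbhs_enormP[e e0 eU].
have V1 : 0 < V + 1 by rewrite ltr_wpDl.
apply/nbhs_ballP; exists (e / (V + 1)) => /=; first by rewrite divr_gt0.
move=> t st At; apply: eU; rewrite /eball/=; apply: le_lt_trans (ylip _ _ At As) _.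
move: st; rewrite -ball_normE /ball_/= ltr_pdivlMr// distrC mulrC.
by apply: le_lt_trans; rewrite ler_wpM2r// lerDl.
Qed.

(** [Kset] is bounded and contains every reward, so [vmax] is the supremum of a bounded set. *)
Lemma vmax_ge (R : realType) (d : nat) (St Up Ua : finType)
  (M : setting R d St Up Ua) (HM : standing_assumptions M) s a b z :
  Kset M z -> enorm (kappa M s a b - z) <= vmax M.
Proof.
move=> Kz; have [C CK] := Kset_bounded HM.
apply: sup_ubound.
  exists (C + C) => _ [z' Kz' [] [[s' a'] b'] _ <-] /=.
  apply: le_trans (ler_enormD _ _) _; rewrite enormN.
  by apply: lerD; apply: CK => //; exact: (kappa_Kset HM).
by exists z => //; exists (s, a, b).
Qed.

Section Scheme.
Variables (R : realType) (d : nat) (St Up Ua : finType).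
Variables (M : setting R d St Up Ua) (HM : standing_assumptions M).
Let D := target M.
Let D0 : D !=set0 := target_nonempty HM.
Let Dc : compact (closure D) := closure_target_compact HM.
Let V := vmax M.
Hypothesis pia0 : strategies R St Ua !=set0.
Variable x : nat -> 'rV[R]_d.
Hypothesis xK : forall n, Kset M (x n).
Hypothesis xstep : forall n, enorm (x n.+1 - x n) <= V * n.+1%:R^-1.

Let V0 : 0 <= V.
Proof. by have := le_trans (enorm_ge0 _) (xstep 0); rewrite invr1 mulr1. Qed.

Let durM n : off_target M (x n) -> 0 < dur M (Qpt M (x n)).
Proof. exact: dur_Qpt_gt0. Qed.

Lemma vmax_dur q : Qset M q -> V * dur M q < rho M q / 3.
Proof.
move=> qQ; have /andP[_] := dur_bounds HM qQ; rewrite -/V.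
(* With V = 0 the quotient rho/(3V) is 0 by convention, and the upper bound on the duration
   contradicts its positivity. *)
have [VE|Vn0] := eqVneq V 0.
  by rewrite VE mulr0 invr0 mulr0 ltNge ltW// (dur_gt0 HM qQ).
have Vp : 0 < V by rewrite lt_def Vn0 V0.
by rewrite ltr_pdivlMr ?mulr_gt0// ltr_pdivlMr//; lra.
Qed.

(** On the closure of D one has y_D = y, so the drift inner product vanishes, whereas on the ball it
    is at least c > 0; [pia0] supplies a reward to test it on. *)
Lemma eball_rho_off q y : Qset M q -> eball q (rho M q) y -> ~ closure D y.
Proof.
move=> qQ yq Dy; have [c c0 drf] := rewards_drift HM qQ.
have [pia sp] := pia0.
have kR : closure (rewards M (strat M q)) (kbar M (strat M q) pia).
  by apply: subset_closure; exists pia.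
have := drf _ _ yq kR; rewrite (proj_id D0 Dc Dy) subrr.
by rewrite -(scale0r 0) dotpZr mul0r leNgt c0.
Qed.

(** The closest point to y lies outside B(q, rho(q)), while y is within rho(q)/2 of q. *)
Lemma rho_le_cdist q y : Qset M q -> eball q (rho M q / 2) y ->
  rho M q / 2 <= cdist D y.
Proof.
move=> qQ yq; have Dp := (projP D0 Dc y).1.
have : ~ eball q (rho M q) (proj D y) by move=> /(eball_rho_off qQ).
rewrite /eball/= in yq * => /negP; rewrite -leNgt => h.
have := ler_enorm_dist (proj D y) y q; rewrite (enormC (proj D y) y) -/(cdist D y).
by lra.
Qed.

Let s := switch M x.

Lemma ybar_switch l : x (s l.+1) = ybar M x l (clock R (s l.+1) - clock R (s l)).
Proof. by rewrite ybarE minxx addrC subrK xbar_clock. Qed.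

Lemma switch_clock l : off_target M (x (s l)) -> (0 < l)%N ->
  `|clock R (s l.+1) - clock R (s l) - dur M (Qpt M (x (s l)))| <= l%:R^-1.
Proof.
move=> lo l0; apply: le_trans (next_switch_clock durM lo _) _.
  by apply: leq_trans l0 _; exact: leq_switch.
rewrite lef_pV2 ?posrE ?ltr0n ?ler_nat ?leq_switch//.
by apply: leq_trans l0 _; exact: leq_switch.
Qed.

Hypothesis nonexc : ~ exceptional M x.

(** Here a, a' are the distances at the two ends of the limit trajectory and b, b' those of the
    actual one, compared up to e. The error 4ae + e^2 is at most e(4a + 1) <= g, half of the
    available decrease 2g. *)
Let descent (a a' b b' g e : R) : 0 <= a -> 0 <= a' -> 0 <= b' ->
  0 < g -> 0 <= e <= 1 -> e * (4 * a + 1) <= g ->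
  a' ^+ 2 <= a ^+ 2 - g * 2 -> b' <= a' + e -> a <= b + e ->
  b' ^+ 2 <= b ^+ 2 - g.
Proof.
move=> a0 a0' b0' g0 /andP[e0 e1] eg aa b'a ab.
have aa' : a' <= a by rewrite -(ler_pXn2r (n := 2))// ?nnegrE//; lra.
have h1 : b' ^+ 2 <= (a' + e) ^+ 2 by rewrite ler_pXn2r ?nnegrE// addr_ge0.
have h2 : 0 <= (b - a) ^+ 2 by exact: sqr_ge0.
have h3 := ler_wpM2r e0 aa'.
have h4 := ler_wpM2l a0 ab.
have h5 := ler_wpM2l e0 e1.
move: h1 h2 aa eg; rewrite sqrrD sqrrB !expr2; lra.
Qed.

(** By contradiction: infinitely many failures at the same q have a limit trajectory, which must
    decrease because x is not exceptional; nearby actual trajectories then decrease too. *)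
Lemma switch_decrease q : Qset M q -> exists2 c, 0 < c &
  exists N, forall l, (N <= l)%N -> off_target M (x (s l)) ->
    Qpt M (x (s l)) = q ->
    cdist D (x (s l.+1)) ^+ 2 <= cdist D (x (s l)) ^+ 2 - c.
Proof.
move=> qQ; have T0 := dur_gt0 HM qQ; set T := dur M q in T0.
have VT := vmax_dur qQ; have rho0 := rho_gt0 HM (Qset_off_target HM qQ).
have VT2 : V * dur M q < rho M q / 2 by lra.
have [g2 g20 gP] := limit_trajectory_decrease HM qQ V0 VT2.
(* Half of the limit decrease; the other half absorbs the approximation errors. *)
pose g := g2 / 2; have g0 : 0 < g by rewrite divr_gt0.
exists g => //; apply: contrapT => /forallNP nodec.
pose B := [set l | [/\ (0 < l)%N, off_target M (x (s l)), Qpt M (x (s l)) = q &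
  ~ (cdist D (x (s l.+1)) ^+ 2 <= cdist D (x (s l)) ^+ 2 - g)]].
have Binf N : exists2 l, (N <= l)%N & B l.
  apply: contrapT => no; apply: (nodec (maxn N 1)) => l Nl lo lq.
  apply: contrapT => nd; apply: no; exists l.
    by apply: leq_trans Nl; exact: leq_maxl.
  by split=> //; apply: leq_trans Nl; exact: leq_maxr.
have [C CK] := Kset_bounded HM.
have clk l : B l -> `|clock R (s l.+1) - clock R (s l) - T| <= l%:R^-1.
  by move=> [l0 lo lq _]; have := switch_clock lo l0; rewrite lq.
(* For l >= 1 the interval has length at most T + 1/l <= T + 1, so the trajectories are stopped by
   that time. *)
have gconst l t : B l -> T + 1 <= t -> ybar M x l t = ybar M x l (T + 1).
  move=> Bl Tt; have [l0 _ _ _] := Bl; rewrite !ybarE.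
  set tau := clock _ _ - _; have tauT : tau <= T + 1.
    have := le_trans (ler_norm _) (clk _ Bl); rewrite -/tau.
    have : l%:R^-1 <= 1 :> R by rewrite invf_le1 ?ltr0n// ler1n.
    by lra.
  by rewrite !min_r// (le_trans tauT).
have g0C l : B l -> enorm (ybar M x l 0) <= C.
  by move=> _; rewrite ybar0//; exact: CK.
have glip l u t : B l -> 0 <= u -> 0 <= t ->
  enorm (ybar M x l u - ybar M x l t) <= V * `|u - t| by move=> _; exact: ybar_lip.
have [m [y [mlt mB ylip my]]] := @ascoli_subsequence R d (ybar M x) B C V (T + 1)
    V0 (addr_ge0 (ltW T0) ler01) Binf
    g0C glip gconst.
have m_gt n : (n < m n)%N.
  elim: n => [|n IHn]; first by case: (mB 0%N).
  exact: leq_ltn_trans IHn (mlt _ _ (ltnSn n)).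
have y0m e : 0 < e -> \forall n \near \oo, enorm (x (s (m n)) - y 0) < e.
  move=> e0; have := my e e0; apply: filterS => n /(_ 0 (lexx 0)).
  by rewrite ybar0.
have y0q : enorm (y 0 - q) <= rho M q / 2.
  apply/ler_addgt0Pr => e e0; have [n ne] := filter_ex (y0m e e0).
  have [_ lo lq _] := mB n; have [_ + _] := QptP HM lo; rewrite lq /eball/= => nq.
  have := ler_enorm_dist (y 0) (x (s (m n))) q; rewrite (enormC (y 0) (x _)).
  by lra.
(* The closed ball of radius rho(q)/2 lies in B(q, rho(q)), which avoids the closure of D; the
   exceptional set asks for a limit point of this kind. *)
have y0off : off_target M (y 0).
  split.
    apply: (Kset_closed HM); apply/closure_enormP => e e0.
    have [n ne] := filter_ex (y0m e e0).
    by exists (x (s (m n))) => //; rewrite enormC.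
  by apply: (eball_rho_off qQ); rewrite /eball/=; apply: le_lt_trans y0q _; lra.
(* Otherwise the subsequence [m] and its limit [y] would witness that x is exceptional. *)
have kcl j k : (j < 2 ^ k)%N ->
    closure (rewards M (strat M q)) (kappa_jk (dur M q) j k y).
  move=> jk; apply: contrapT => nk; apply: nonexc.
  exists q => //; exists k => //; exists j => //; exists m, y; split=> //.
  - by exists (y 0) => //; exact: enorm_cvg.
  - by move=> n; have [_ ? ? _] := mB n.
  - split.
      apply: (within_continuous_enorm_lip V0) => u t.
      by rewrite /= !in_itv/= !andbT; exact: ylip.
    move=> K _ K0; apply: uniform_enorm_cvg => e e0.
    have := my e e0; apply: filterS => n h t /K0/=.
    by rewrite in_itv/= andbT; exact: h.
have dec := gP y ylip y0q kcl; rewrite -/T -/D in dec.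
have a0 := cdist_ge0 D (y 0); set a := cdist D (y 0) in a0 dec.
have a1 : 0 < 4 * a + 1 by rewrite ltr_wpDl// mulr_ge0.
have [e [e0 e1 eg]] : exists e, [/\ 0 < e, e <= 1 & e * (4 * a + 1) <= g].
  exists (Num.min 1 (g / (4 * a + 1))); split.
  - by rewrite lt_min ltr01 divr_gt0.
  - by rewrite ge_min lexx.
  - by rewrite -ler_pdivlMr// ge_min lexx orbT.
have e20 : 0 < e / 2 by rewrite divr_gt0.
have V1 : 0 < V + 1 by rewrite ltr_wpDl.
have small := @near_infty_natSinv_lt R (PosNum (divr_gt0 e20 V1)).
have [n [/= nsmall [ny nx]]] :=
  filter_ex (filterI small (filterI (my _ e20) (y0m e e0))).
have dec2 : cdist D (y T) ^+ 2 <= a ^+ 2 - g * 2 by rewrite /g divfK.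
have ab : a <= cdist D (x (s (m n))) + e.
  apply: le_trans (cdist_lip D0 Dc _ (x (s (m n)))) _.
  by rewrite lerD2l enormC ltW.
(* The actual interval has length tau, not T; |tau - T| <= 1/m(n) and the Lipschitz bound make
   y(tau) and y(T) differ by at most e/2. *)
have ba : cdist D (x (s (m n).+1)) <= cdist D (y T) + e.
  apply: le_trans (cdist_lip D0 Dc _ (y T)) _; rewrite lerD2l.
  rewrite ybar_switch; set tau := clock _ _ - _.
  have tau0 : 0 <= tau by rewrite subr_ge0 ltW// ltr_clock// switch_gt.
  apply: le_trans (ler_enorm_dist _ (y tau) _) _.
  rewrite [leRHS]splitr; apply: lerD; first exact: ltW (ny _ tau0).
  apply: le_trans (ylip _ _ tau0 (ltW T0)) _.
  have h : `|tau - T| <= e / 2 / (V + 1).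
    apply: le_trans (clk _ (mB n)) _; apply: le_trans (ltW nsmall).
    have mn0 : (0 < m n)%N by exact: leq_ltn_trans (m_gt n).
    by rewrite lef_pV2 ?posrE ?ltr0n// ler_nat m_gt.
  apply: le_trans (ler_wpM2l V0 h) _.
  by rewrite mulrA ler_pdivrMr// mulrC ler_wpM2l ?(ltW e20)// lerDl.
have e01 : 0 <= e <= 1 by rewrite (ltW e0).
have [_ _ _] := mB n; apply.
exact: (descent a0 (cdist_ge0 _ _) (cdist_ge0 _ _) g0 e01 eg dec2 ba ab).
Qed.

End Scheme.

(** * Convergence *)

(** Otherwise f^2 would be negative after floor(f(N)^2 / c) + 1 steps. *)
Lemma sqr_descent_lt (R : realType) (f : nat -> R) (c e : R) (N : nat) :
  0 < c -> (forall l, (N <= l)%N -> e <= f l -> f l.+1 ^+ 2 <= f l ^+ 2 - c) ->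
  exists2 l, (N <= l)%N & f l < e.
Proof.
move=> c0 fc; apply: contrapT => no.
have far l : (N <= l)%N -> e <= f l.
  by move=> Nl; rewrite leNgt; apply/negP => h; apply: no; exists l.
have dec j : f (N + j)%N ^+ 2 <= f N ^+ 2 - j%:R * c.
  elim: j => [|j IHj]; first by rewrite addn0 mul0r subr0.
  have Nj : (N <= N + j)%N by exact: leq_addr.
  rewrite addnS; apply: le_trans (fc _ Nj (far _ Nj)) _.
  by rewrite -[j.+1%:R]natr1 mulrDl mul1r opprD addrA lerD2r.
have /andP[_] := truncn_itv (divr_ge0 (sqr_ge0 (f N)) (ltW c0)).
rewrite ltr_pdivrMr// => fN.
have := le_trans (sqr_ge0 _) (dec (Num.trunc (f N ^+ 2 / c)).+1).
by rewrite subr_ge0 leNgt fN.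
Qed.

Section Convergence.
Variables (R : realType) (d : nat) (St Up Ua : finType).
Variables (M : setting R d St Up Ua) (HM : standing_assumptions M).
Let D := target M.
Let D0 : D !=set0 := target_nonempty HM.
Let Dc : compact (closure D) := closure_target_compact HM.
Let V := vmax M.

(** Such points lie in finitely many shells, each with a finite Q_n, and [Qpt] has the least index
    among all candidates. The index is bounded rather than the shell, since [Qpt] may come from
    another shell. *)
Lemma idx_Qpt_bounded e : 0 < e -> exists b, forall y, off_target M y ->
  e <= cdist D y -> (idx M (Qpt M y) < b)%N.
Proof.
move=> e0; have /choice[b bP] (n : nat) :
    exists b, forall q, Qn M n q -> (idx M q <= b)%N.
  have /finite_seqP[r rE] := Qn_finite HM n.
  exists (\max_(q <- r) idx M q)%N => q; rewrite rE => /= qr.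
  by apply: leq_bigmax_seq.
exists (\max_(i < (Num.trunc e^-1).+1) b i).+1 => y yo ey.
have ey' := le_trans ey (cdist_le_edist D0 Dc y).
have [n nb ny] := shell_exists e0 yo.1 ey'.
have [q qn yq] := Qn_cover HM ny; have [_ _ Qmin] := QptP HM yo.
rewrite ltnS; apply: leq_trans (Qmin q _ yq) _; first by exists n.
apply: leq_trans (bP n q qn) _; rewrite -ltnS in nb.
exact: (leq_bigmax (Ordinal nb)).
Qed.

Hypothesis pia0 : strategies R St Ua !=set0.
Variable x : nat -> 'rV[R]_d.
Hypothesis xK : forall n, Kset M (x n).
Hypothesis xstep : forall n, enorm (x n.+1 - x n) <= V * n.+1%:R^-1.
Hypothesis nonexc : ~ exceptional M x.

Let V0 : 0 <= V.
Proof. by have := le_trans (enorm_ge0 _) (xstep 0); rewrite invr1 mulr1. Qed.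

Let durM n : off_target M (x n) -> 0 < dur M (Qpt M (x n)).
Proof. exact: dur_Qpt_gt0. Qed.

Let s := switch M x.

(** Injectivity of [idx] leaves at most one new q at each step of the induction, so a minimum of
    constants and a maximum of thresholds suffice. *)
Lemma switch_decrease_idx b : exists2 c, 0 < c &
  exists N, forall l, (N <= l)%N -> off_target M (x (s l)) ->
    (idx M (Qpt M (x (s l))) < b)%N ->
    cdist D (x (s l.+1)) ^+ 2 <= cdist D (x (s l)) ^+ 2 - c.
Proof.
elim: b => [|b [c c0 [N cN]]]; first by exists 1 => //; exists 0%N.
have [[q [qQ qb]]|no] := pselect (exists q, Qset M q /\ idx M q = b); last first.
  exists c => //; exists N => l Nl lo.
  rewrite ltnS leq_eqVlt => /orP[/eqP lb|]; last exact: cN.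
  by exfalso; apply: no; exists (Qpt M (x (s l))); have [] := QptP HM lo.
have [c' c'0 [N' cN']] := switch_decrease HM pia0 xK xstep nonexc qQ.
exists (Num.min c c'); first by rewrite lt_min c0.
exists (maxn N N') => l; rewrite geq_max => /andP[Nl N'l] lo.
rewrite ltnS leq_eqVlt => /orP[/eqP lb|lb]; last first.
  apply: le_trans (cN l Nl lo lb) _.
  by rewrite lerD2l lerN2 ge_min lexx.
have lq : Qpt M (x (s l)) = q.
  have [Ql _ _] := QptP HM lo.
  by apply: (idx_inj HM); rewrite ?inE// lb qb.
apply: le_trans (cN' l N'l lo lq) _.
by rewrite lerD2l lerN2 ge_min lexx orbT.
Qed.

Lemma off_target_iff n : off_target M (x n) <-> 0 < cdist D (x n).
Proof.
split=> [/(off_target_cdist HM)//|h]; split=> // /(cdist_eq0 D0 Dc) h0.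
by rewrite h0 ltxx in h.
Qed.

Lemma switch_decrease_far e : 0 < e -> exists2 c, 0 < c &
  exists N, forall l, (N <= l)%N -> e <= cdist D (x (s l)) ->
    cdist D (x (s l.+1)) ^+ 2 <= cdist D (x (s l)) ^+ 2 - c.
Proof.
move=> e0; have [b bP] := idx_Qpt_bounded e0.
have [c c0 [N cN]] := switch_decrease_idx b.
exists c => //; exists N => l Nl el.
have lo : off_target M (x (s l)) by apply/off_target_iff; exact: lt_le_trans el.
by apply: cN => //; exact: bP.
Qed.

Lemma switch_near_frequently e N : 0 < e ->
  exists2 l, (N <= l)%N & cdist D (x (s l)) < e.
Proof.
move=> e0; have [c c0 [N' cN]] := switch_decrease_far e0.
have [|l Nl le] := @sqr_descent_lt R (fun l => cdist D (x (s l))) c e (maxn N N') c0.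
  by move=> l; rewrite geq_max => /andP[_]; exact: cN.
by exists l => //; apply: leq_trans Nl; exact: leq_maxl.
Qed.

(** Off target the clock advances by at most T(q) + 1/l, and V T(q) < rho(q)/3 is at most 2/3 of the
    distance. On target the switch comes after one step, of size at most V/l. *)
Lemma switch_displacement l i : (0 < l)%N -> (s l <= i <= s l.+1)%N ->
  enorm (x i - x (s l)) <= 2 / 3 * cdist D (x (s l)) + V / l%:R.
Proof.
have arith (u v a b c : R) :
  v < b / 3 -> b / 2 <= c -> a <= v + u -> a <= 2 / 3 * c + u.
  by lra.
move=> l0 /andP[li il]; apply: le_trans (dist_clock xstep li) _.
have [lo|nlo] := pselect (off_target M (x (s l))).
  have [Ql lq _] := QptP HM lo.
  apply: arith (vmax_dur HM xstep Ql) (rho_le_cdist HM pia0 Ql lq) _.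
  rewrite -mulrDr; apply: ler_wpM2l => //.
  have := switch_clock HM lo l0; rewrite ler_norml => /andP[_].
  rewrite lerBlDl; apply: le_trans; rewrite lerD2r; exact: ler_clock.
have -> : cdist D (x (s l)) = 0.
  by apply/eqP; rewrite eq_le cdist_ge0 andbT leNgt; apply/negP => /off_target_iff.
rewrite mulr0 add0r; apply: ler_wpM2l => //.
apply: (@le_trans _ _ (clock R (s l).+1 - clock R (s l))).
  by rewrite lerD2r; apply: ler_clock; rewrite -(next_switch_off nlo).
rewrite clockS addrAC subrr add0r lef_pV2 ?posrE ?ltr0n// ler_nat.
by apply: leqW; exact: leq_switch.
Qed.

(** With f the distance and l large: if f(x_{s_l}) < e, the next switching value is at most 5e/3 +
    e/3 = 2e; if f(x_{s_l}) >= e, it does not increase. So 2e persists at the switches, and between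
    them f <= 10e/3 + e/3 <= 4e. *)
Lemma eventually_near e : 0 < e -> \forall n \near \oo, cdist D (x n) <= 4 * e.
Proof.
have arith (u v w r : R) : u <= v + w -> w <= 2 / 3 * v + r -> r <= e / 3 ->
  u <= 5 / 3 * v + e / 3 by lra.
have arith2 (u v : R) : u <= 5 / 3 * v + e / 3 -> v < e -> u <= 2 * e by lra.
have arith3 (u v c : R) :
    0 <= u -> 0 <= v -> 0 < c -> u ^+ 2 <= v ^+ 2 - c -> u <= v.
  move=> u0 v0 c0 h; rewrite -(ler_pXn2r (n := 2))//.
  by apply: le_trans h _; rewrite gerBl ltW.
have arith4 (u v : R) :
  0 < e -> u <= 5 / 3 * v + e / 3 -> v <= 2 * e -> u <= 4 * e by lra.
move=> e0; have [c c0 [N cN]] := switch_decrease_far e0.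
have e2 : e <= 2 * e by rewrite ler_peMl ?(ltW e0)// ler1n.
have [k kV] : exists k, V / k.+1%:R <= e / 3.
  exists (Num.trunc (V / (e / 3))).
  rewrite ler_pdivrMr// mulrC -ler_pdivrMr ?divr_gt0//.
  by have /andP[_ /ltW] := truncn_itv (divr_ge0 V0 (divr_ge0 (ltW e0) (ler0n R 3))).
(* The start has a value below e and lies beyond N, for the decrease, and beyond k, for V/l <=
   e/3. *)
have [l0 l0N l0e] := switch_near_frequently (maxn N k.+1) e0.
have Vl l : (l0 <= l)%N -> [/\ (N <= l)%N, (0 < l)%N & V / l%:R <= e / 3].
  move=> /(leq_trans l0N); rewrite geq_max => /andP[Nl kl].
  have lp : (0 < l)%N by exact: leq_ltn_trans kl.
  split=> //; apply: le_trans kV; apply: ler_wpM2l => //.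
  by rewrite lef_pV2 ?posrE ?ltr0n// ler_nat.
have near_l l i : (l0 <= l)%N -> (s l <= i <= s l.+1)%N ->
    cdist D (x i) <= 5 / 3 * cdist D (x (s l)) + e / 3.
  move=> l0l il; have [_ lp Vle] := Vl l l0l.
  exact: arith (cdist_lip D0 Dc _ _) (switch_displacement lp il) Vle.
have le2e l : (l0 <= l)%N -> cdist D (x (s l)) <= 2 * e.
  elim: l => [|l IHl].
    by rewrite leqn0 => /eqP l00; rewrite l00 in l0e; exact: le_trans (ltW l0e) e2.
  rewrite leq_eqVlt => /orP[/eqP<-|]; first exact: le_trans (ltW l0e) e2.
  rewrite ltnS => l0l; have [le|el] := ltP (cdist D (x (s l))) e.
    by apply: arith2 le; apply: near_l => //; rewrite leqnn andbT ltnW// switch_gt.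
  have [Nl _ _] := Vl l l0l; apply: le_trans (IHl l0l).
  exact: arith3 (cdist_ge0 _ _) (cdist_ge0 _ _) c0 (cN l Nl el).
exists (s l0) => // i /= l0i; have [l /andP[li il]] := switch_cell durM i.
have l0l : (l0 <= l)%N.
  rewrite leqNgt; apply/negP => ll0.
  by have := leq_trans (homo_switch durM ll0) l0i; rewrite leqNgt il.
apply: (arith4 _ _ e0 _ (le2e l l0l)); apply: near_l => //.
by rewrite li ltnW.
Qed.

Lemma cluster_target z : cluster (x @ \oo) z -> closure D z.
Proof.
move=> xz; apply/(cdist_eq0 D0 Dc)/le_anti; rewrite cdist_ge0 andbT.
(* With this e the tail has f <= f(z)/2; a tail point within f(z)/4 of z would give f(z) < 3
   f(z)/4. *)
rewrite leNgt; apply/negP => z0; have e0 : 0 < cdist D z / 8 by rewrite divr_gt0.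
have z4 : 0 < cdist D z / 4 by rewrite divr_gt0.
have nz : nbhs z (eball z (cdist D z / 4)).
  by apply/nbhs_enormP; exists (cdist D z / 4).
have xe : (x @ \oo) [set v | cdist D v <= 4 * (cdist D z / 8)] := eventually_near e0.
have [y [/= ye]] := xz _ _ xe nz; rewrite /eball/= enormC => yz.
move: (cdist_lip D0 Dc z y) ye yz z0.
move: (cdist D z) (cdist D y) (enorm _) => a b c.
by lra.
Qed.

End Convergence.

Theorem theorem18 (R : realType) (d : nat) (St Up Ua : finType)
  (M : setting R d St Up Ua) (HM : standing_assumptions M)
  (disp : measure_display) (Omega : measurableType disp)
  (P : probability Omega R) (F : nat -> set (set Omega))
  (th : nat -> Omega -> St) (up : nat -> Omega -> Up) (ua : nat -> Omega -> Ua)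
  (pip : nat -> Omega -> St -> Up -> R) (pia : nat -> Omega -> St -> Ua -> R)
  (x : nat -> Omega -> 'rV[R]_d)
  (Hproc : controlled_process M P F th up ua pip pia x)
  (w : Omega) (Hw : ~ exceptional M (fun n => x n w))
  (z : 'rV[R]_d) (Hz : cluster ((fun n => x n w) @ \oo) z) :
  closure (target M) z.
Proof.
(* Once the realization avoids the exceptional set the argument is deterministic; its increments
   (kappa - x_n)/(n+1) have norm at most [vmax]/(n+1). *)
apply: (cluster_target HM _ _ _ Hw Hz).
- by exists (pia 0%N w); exact: (pia_strategy Hproc).
- by move=> n; exact: (x_Kset Hproc).
move=> n; rewrite (x_rec Hproc) addrAC subrr add0r enormZ.
rewrite ger0_norm ?invr_ge0// mulrC ler_wpM2r ?invr_ge0//.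
by apply: (vmax_ge HM); exact: (x_Kset Hproc).
Qed.
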